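(* Let $a\ge 2$ and $k\ge 1$ be integers. Then $$\sum_{n\in\mathbb{Z}}\frac{(-1)^{nk}}{(an+1)^k}=\left(\frac{\pi}{a}\csc\frac{\pi}{a}\right)^k\left[\left(\int_0^1\frac{\frac{a}{\pi}\sin(\frac{\pi}{a})}{1+\xi^a}\,d\xi\right)^k+\left(\int_0^1\frac{\frac{a}{\pi}\sin(\frac{\pi}{a})\,\theta^{a-2}}{1+\theta^a}\,d\theta\right)^k+\sum_{n=1}^{\lfloor k/2\rfloor}\ \sum_{(r_1,\dots,r_n)}\bigl(J_{r_1,\dots,r_n}+K_{r_1,\dots,r_n}\bigr)\right],$$ where the inner sum runs over all ordered tuples $(r_1,\dots,r_n)\in\{1,\dots,k\}^n$ such that $|r_i-r_j|\notin\{0,1,k-1\}$ for all $i\ne j$ in $\{1,\dots,n\}$, and $J_{r_1,\dots,r_n}$, $K_{r_1,\dots,r_n}$ are the integrals defined in the context.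
   Context: Let $\psi(t)=\int_0^t \frac{\frac{a}{\pi}\sin(\pi/a)}{1+\xi^a}\,d\xi$ and $\phi(t)=\int_0^t\frac{\frac{a}{\pi}\sin(\pi/a)\,\theta^{a-2}}{1+\theta^a}\,d\theta$ for $t\ge 0$. For a tuple $(r_1,\dots,r_n)$ as in the claim, and $j\in\{1,\dots,n\}$, let $\alpha_j$ be the number of distinct indices $z\in\{r_j-1,r_j+1\}$ (taken cyclically mod $k$ in $\{1,\dots,k\}$) that are not cyclically adjacent to $r_m$ for any $m<j$ (i.e. $z\not\equiv r_m\pm1 \pmod k$ for all $m<j$). Define $$J_{r_1,\dots,r_n}=\psi(1)^{\,k-n-\sum_{j=1}^n\alpha_j}\int_{1\le\xi_{r_n}\le\cdots\le\xi_{r_1}}\frac{\left(\frac{a}{\pi}\sin\frac{\pi}{a}\right)^n\prod_{j=1}^n\psi(1/\xi_{r_j})^{\alpha_j}}{(1+\xi_{r_1}^a)\cdots(1+\xi_{r_n}^a)}\,d\xi_{r_n}\cdots d\xi_{r_1},$$ $$K_{r_1,\dots,r_n}=\phi(1)^{\,k-n-\sum_{j=1}^n\alpha_j}\int_{1\le\theta_{r_n}\le\cdots\le\theta_{r_1}}\frac{\left(\frac{a}{\pi}\sin\frac{\pi}{a}\right)^n\prod_{j=1}^n\phi(1/\theta_{r_j})^{\alpha_j}\theta_{r_j}^{a-2}}{(1+\theta_{r_1}^a)\cdots(1+\theta_{r_n}^a)}\,d\theta_{r_n}\cdots d\theta_{r_1}.$$ The two-sided series on the left is understood as $\sum_{n\ge0}+\sum_{n\le-1}$,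 each one-sided series summed in order of increasing $|n|$ (this matters only for $k=1$). Empty sums are $0$. *)

(* Defs.v *)
From HB Require Import structures.
From mathcomp Require Import all_boot all_order all_algebra.
From mathcomp Require Import all_classical all_reals all_analysis.

Set Implicit Arguments.
Unset Strict Implicit.
Unset Printing Implicit Defensive.

Import Order.TTheory GRing.Theory Num.Theory.
Import numFieldNormedType.Exports.

Local Open Scope classical_set_scope.
Local Open Scope ring_scope.

Definition cst_sin (R : realType) (a : nat) : R :=
  a%:R / pi * sin (pi / a%:R).

Definition psi (R : realType) (a : nat) (t : R) : R :=
  \int[lebesgue_measure]_(xi in `[0, t]) (cst_sin R a / (1 + xi ^+ a)).

Definition phi (R : realType) (a : nat) (t : R) : R :=
  \int[lebesgue_measure]_(theta in `[0, t])
    (cst_sin R a * theta ^+ (a - 2) / (1 + theta ^+ a)).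

Definition lhs_term (R : realType) (a k : nat) (n : int) : R :=
  ((-1) ^ (n * k%:Z)) / (a%:Z * n + 1)%:~R ^+ k.

(* The cyclic index set {1, ..., k} is represented by 'I_k, the ordinal i
   standing for the index i + 1; every notion below is invariant under this
   shift. *)

Definition cyc_nbrs (k : nat) (x : 'I_k) : {set 'I_k} :=
  [set ord_pred x; ordS x].

Definition admissible (k n : nat) (r : n.-tuple 'I_k) : bool :=
  [forall i : 'I_n, forall j : 'I_n, (i != j) ==>
    (`|(tnth r i)%:Z - (tnth r j)%:Z|%N \notin [:: 0; 1; k - 1]%N)].

Definition alpha (k n : nat) (r : n.-tuple 'I_k) (j : 'I_n) : nat :=
  #|[set z in cyc_nbrs (tnth r j) |
      [forall m : 'I_n, (m < j)%N ==> (z \notin cyc_nbrs (tnth r m))]]|.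

(* For an admissible r with 2 <= k and 0 < n this natural-number subtraction
   is exact: the sets counted by the alpha_j are pairwise disjoint and contain
   no entry of r, and the n entries of r are distinct. *)
Definition free_exp (k n : nat) (r : n.-tuple 'I_k) : nat :=
  (k - n - \sum_(j < n) alpha r j)%N.

(* Integral of F (x_1, ..., x_n) over 1 <= x_n <= ... <= x_1 <= u, as the
   iterated Lebesgue integral dx_n ... dx_1 (x_1 outermost). *)
Fixpoint simplex_int (R : realType) (n : nat) :
    (n.-tuple R -> \bar R) -> \bar R -> \bar R :=
  match n with
  | 0 => fun F _ => F [tuple]
  | n'.+1 => fun F u =>
      (\int[lebesgue_measure]_(x in [set x : R | (1 <= x)%R /\ (x%:E <= u)%E])
         simplex_int (fun s : n'.-tuple R => F [tuple of x :: s]) x%:E)%E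
  end.

(* The j-th integration variable xi_j below is the one written xi_{r_j} in the
   definition of J_{r_1, ..., r_n}, and likewise for K. Both are valued in
   \bar R, so that an equation with a finite value entails that the improper
   integrals converge. *)
Definition Jint (R : realType) (a k n : nat) (r : n.-tuple 'I_k) : \bar R :=
  ((psi a (1 : R) ^+ free_exp r)%R%:E * simplex_int (fun xi : n.-tuple R =>
    (cst_sin R a ^+ n *
     (\prod_(j < n) psi a (1 / tnth xi j) ^+ alpha r j) /
     (\prod_(j < n) (1 + tnth xi j ^+ a)))%R%:E) +oo)%E.

Definition Kint (R : realType) (a k n : nat) (r : n.-tuple 'I_k) : \bar R :=
  ((phi a (1 : R) ^+ free_exp r)%R%:E * simplex_int (fun theta : n.-tuple R =>
    (cst_sin R a ^+ n *
     (\prod_(j < n) (phi a (1 / tnth theta j) ^+ alpha r j *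
                     tnth theta j ^+ (a - 2))) /
     (\prod_(j < n) (1 + tnth theta j ^+ a)))%R%:E) +oo)%E.

(* Main.v *)
Require Import Defs.
From HB Require Import structures.
From mathcomp Require Import all_boot all_order all_algebra.
From mathcomp Require Import all_classical all_reals all_analysis.
From mathcomp Require Import measurable_realfun zify ring.
Import Order.TTheory GRing.Theory Num.Theory.
Import numFieldNormedType.Exports.
Local Open Scope classical_set_scope.
Local Open Scope ring_scope.

Set Implicit Arguments.
Unset Strict Implicit.
Unset Printing Implicit Defensive.

(** Put w_d(x) = x^(d-1)/(1+x^a) and v_d = w_(a-d).  Up to the constant
    ((a/pi) sin(pi/a))^k, the J-half (d = 1) and the K-half (d = a-1) of the
    bracket are the integrals of w_d(x_1)...w_d(x_k) over the region
    x_i x_(i+1) < 1 (indices cyclic), i.e. the traces of T^k for the operators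
    (T f)(x) = \int_0^(1/x) f w_d; a tuple (r_1, ..., r_n) collects the points
    whose coordinates above 1 are x_(r_1) >= ... >= x_(r_n).

    Instead of the k-dimensional region, follow the Fredholm determinant
    det(1 - zT_u) of T truncated to [0, u], a power series in z whose
    coefficients are functions of u.  Removing the largest coordinate turns the
    integrals for the cycle and for paths into a Riccati system in u, which is
    linearized by X' = - z v_d Y, Y' = z w_d X.  For u -> oo the determinant
    becomes D_d(z) = X(1) - Y(1), where (X, Y) is the solution starting at
    (1, 0).  The contiguity relation D_d(z) = (1 - z/d) D_(d+a)(-z), read off on
    the coefficients C_k of - z D'/D, is C_k(d) = d^-k + (-1)^k C_k(d+a); as
    C_k(d) = O(1/d), iterating it sums the series. *)

(** * Formal power series *)

(** The terms with n >= 0 form the series at d = 1, those with n <= -1 the series at d = a - 1,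
    since 1 - a(m+1) = -((a-1) + am). Iterating contiguity moves d beyond a, where v_d is not
    integrable at 0 and T loses its meaning; the linear system survives because Y vanishes to order
    d at 0. Contiguity is therefore proved for the system and not for integrals. Its source is w_d +
    w_(d+a) = x^(d-1) and v_d + v_(d+a) = x^(-d-1): the primitives x^d/d and -x^(-d)/d give a linear
    change of unknowns from the system for d + a at -z to the one for d at z. With s = 1/u, the
    limit u -> oo becomes s -> 0. At u = 1 the conditions x_i x_(i+1) < 1 hold almost everywhere on
    the unit cube, so T_1 has rank one and its determinant is 1 - z \int_0^1 w_d. This singles out
    the solution with value (1, 1) at s = 1, and D_d is the limit of its second component at s = 0.
    The variable z stays formal: the derivative of the coefficient of z^(n+1) involves only
    coefficients of z^n, so existence and uniqueness are inductions on n, without convergence in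
    z. *)

Record fps (R : realType) := Fps { coef : nat -> R }.

HB.instance Definition _ (R : realType) := gen_eqMixin (fps R).
HB.instance Definition _ (R : realType) := gen_choiceMixin (fps R).

Lemma fpsP (R : realType) (f g : fps R) : (forall n, coef f n = coef g n) -> f = g.
Proof. by case: f g => f [g] /= fg; congr Fps; exact/funext. Qed.

Definition fps_zero (R : realType) := @Fps R (fun=> 0).
Definition fps_one (R : realType) := @Fps R (fun n => (n == 0)%:R).
Definition fps_add (R : realType) (f g : fps R) :=
  Fps (fun n => coef f n + coef g n).
Definition fps_opp (R : realType) (f : fps R) := Fps (fun n => - coef f n).
(** Functions [nat -> R] already carry the pointwise product; the record [fps] keeps the Cauchy
    product apart from it. *)
Definition fps_mul (R : realType) (f g : fps R) :=
  Fps (fun n => \sum_(i < n.+1) coef f i * coef g (n - i)%N).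

Lemma fps_addA (R : realType) : associative (@fps_add R).
Proof. by move=> f g h; apply/fpsP => n /=; rewrite addrA. Qed.

Lemma fps_addC (R : realType) : commutative (@fps_add R).
Proof. by move=> f g; apply/fpsP => n /=; rewrite addrC. Qed.

Lemma fps_add0 (R : realType) : left_id (@fps_zero R) (@fps_add R).
Proof. by move=> f; apply/fpsP => n /=; rewrite add0r. Qed.

Lemma fps_addN (R : realType) :
  left_inverse (@fps_zero R) (@fps_opp R) (@fps_add R).
Proof. by move=> f; apply/fpsP => n /=; rewrite addNr. Qed.

HB.instance Definition _ (R : realType) := GRing.isZmodule.Build (fps R)
  (@fps_addA R) (@fps_addC R) (@fps_add0 R) (@fps_addN R).

(** Coefficient n of a product sees only truncations of the factors, so the ring laws can be
    borrowed from polynomials. *)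
Lemma fps_mul_poly (R : realType) (f g : fps R) N n : (n < N)%N ->
  coef (fps_mul f g) n =
  ((\poly_(i < N) coef f i) * (\poly_(i < N) coef g i))`_n.
Proof.
move=> nN; rewrite coefM /=; apply: eq_bigr => i _.
rewrite !coef_poly (leq_ltn_trans (leq_subr _ _) nN).
by rewrite (leq_ltn_trans _ nN) // -ltnS.
Qed.

Lemma fps_mulA (R : realType) : associative (@fps_mul R).
Proof.
move=> f g h; apply/fpsP => n.
pose P (f : fps R) := \poly_(i < n.+1) coef f i.
have PM f' g' (p q : {poly R}) :
    (forall i, (i <= n)%N -> p`_i = coef f' i) ->
    (forall i, (i <= n)%N -> q`_i = coef g' i) ->
    coef (fps_mul f' g') n = (p * q)`_n.
  move=> pf qg; rewrite coefM; apply: eq_bigr => i _.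
  by rewrite pf -1?ltnS // qg // leq_subr.
have Pc (f' : fps R) i : (i <= n)%N -> (P f')`_i = coef f' i.
  by move=> lin; rewrite coef_poly ltnS lin.
have PMc f' g' i : (i <= n)%N -> (P f' * P g')`_i = coef (fps_mul f' g') i.
  by move=> lin; rewrite (@fps_mul_poly R f' g' n.+1).
rewrite (PM _ _ (P f) (P g * P h)) ?(PM _ _ (P f * P g) (P h)) ?mulrA //.
- by move=> i; exact: PMc.
- exact: Pc.
- exact: Pc.
- by move=> i; exact: PMc.
Qed.

Lemma fps_mulC (R : realType) : commutative (@fps_mul R).
Proof.
by move=> f g; apply/fpsP => n; rewrite !(@fps_mul_poly _ _ _ n.+1) // mulrC.
Qed.

Lemma fps_mul1 (R : realType) : left_id (@fps_one R) (@fps_mul R).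
Proof.
move=> f; apply/fpsP => n /=.
by rewrite big_ord_recl /= mul1r subn0 big1 ?addr0 // => i _; rewrite mul0r.
Qed.

Lemma fps_mulDl (R : realType) : left_distributive (@fps_mul R) (@fps_add R).
Proof.
move=> f g h; apply/fpsP => n /=.
by rewrite -big_split; apply: eq_bigr => i _; rewrite mulrDl.
Qed.

Lemma fps_oner_neq0 (R : realType) : fps_one R != fps_zero R.
Proof.
apply/eqP => /(congr1 (fun f => coef f 0)) /= /eqP.
by rewrite oner_eq0.
Qed.

HB.instance Definition _ (R : realType) := GRing.Zmodule_isComNzRing.Build (fps R)
  (@fps_mulA R) (@fps_mulC R) (@fps_mul1 R) (@fps_mulDl R) (@fps_oner_neq0 R).

Lemma fcoef0 (R : realType) n : coef (0 : fps R) n = 0. Proof. by []. Qed.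
Lemma fcoef1 (R : realType) n : coef (1 : fps R) n = (n == 0)%:R. Proof. by []. Qed.
Lemma fcoefD (R : realType) (f g : fps R) n : coef (f + g) n = coef f n + coef g n.
Proof. by []. Qed.
Lemma fcoefN (R : realType) (f : fps R) n : coef (- f) n = - coef f n.
Proof. by []. Qed.
Lemma fcoefM (R : realType) (f g : fps R) n :
  coef (f * g) n = \sum_(i < n.+1) coef f i * coef g (n - i)%N.
Proof. by []. Qed.
Lemma fcoefM0 (R : realType) (f g : fps R) : coef (f * g) 0 = coef f 0 * coef g 0.
Proof. by rewrite fcoefM big_ord_recl big_ord0 addr0. Qed.

Definition fpsC (R : realType) (c : R) := Fps (fun n => if n is 0 then c else 0).
Definition fpsZ (R : realType) : fps R := Fps (fun n => (n == 1)%:R).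

Lemma fcoefCM (R : realType) c (f : fps R) n : coef (fpsC c * f) n = c * coef f n.
Proof.
by rewrite fcoefM big_ord_recl subn0 big1 ?addr0 // => i _; rewrite mul0r.
Qed.

Lemma fcoefZM (R : realType) (f : fps R) n :
  coef (fpsZ R * f) n = if n is n'.+1 then coef f n' else 0.
Proof.
case: n => [|n]; first by rewrite fcoefM0 mul0r.
rewrite fcoefM 2!big_ord_recl /= mul0r add0r mul1r subSS subn0 big1 ?addr0 //.
by move=> i _; rewrite mul0r.
Qed.

Lemma fpsCM (R : realType) (a b : R) : fpsC (a * b) = fpsC a * fpsC b.
Proof. by apply/fpsP => -[|n]; rewrite fcoefCM //= mulr0. Qed.

Lemma fpsCD (R : realType) (a b : R) : fpsC (a + b) = fpsC a + fpsC b.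
Proof. by apply/fpsP => -[|n] //=; rewrite addr0. Qed.

Lemma fpsCN (R : realType) (a : R) : fpsC (- a) = - fpsC a.
Proof. by apply/fpsP => -[|n] //=; rewrite oppr0. Qed.

Lemma fpsC0 (R : realType) : fpsC 0 = 0 :> fps R.
Proof. by apply/fpsP => -[|n]. Qed.

Lemma fpsC1 (R : realType) : fpsC 1 = 1 :> fps R.
Proof. by apply/fpsP => -[|n]. Qed.

Lemma fps_mul_eq0 (R : realType) (f g : fps R) :
  coef f 0 = 1 -> f * g = 0 -> g = 0.
Proof.
move=> f0 fg0; apply/fpsP => n; elim/ltn_ind: n => n ih.
have := congr1 (fun h => coef h n) fg0.
rewrite fcoefM big_ord_recl /= f0 mul1r subn0 big1 ?addr0 // => i _.
rewrite ih ?mulr0 // /bump /= add1n ltn_subrL /=.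
by apply: leq_trans (ltn_ord i).
Qed.

Lemma fps_mulI (R : realType) (f g h : fps R) :
  coef f 0 = 1 -> f * g = f * h -> g = h.
Proof.
move=> f0 /eqP; rewrite -subr_eq0 -mulrBr => /eqP /(fps_mul_eq0 f0) /eqP.
by rewrite subr_eq0 => /eqP.
Qed.

(** The derivation z d/dz. *)
Definition fps_euler (R : realType) (f : fps R) := Fps (fun n => n%:R * coef f n).

Lemma fps_eulerM (R : realType) (f g : fps R) :
  fps_euler (f * g) = fps_euler f * g + f * fps_euler g.
Proof.
apply/fpsP => n; rewrite fcoefD !fcoefM /= mulr_sumr -big_split /=.
apply: eq_bigr => i _.
have -> : n%:R = i%:R + (n - i)%:R :> R by rewrite -natrD subnKC // -ltnS.
ring.
Qed.

Lemma fps_eulerD (R : realType) (f g : fps R) :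
  fps_euler (f + g) = fps_euler f + fps_euler g.
Proof. by apply/fpsP => n /=; rewrite mulrDr. Qed.

Lemma fps_eulerN (R : realType) (f : fps R) : fps_euler (- f) = - fps_euler f.
Proof. by apply/fpsP => n /=; rewrite mulrN. Qed.

Lemma fps_eulerC (R : realType) (c : R) : fps_euler (fpsC c) = 0.
Proof. by apply/fpsP => -[|n] /=; rewrite ?mul0r ?mulr0. Qed.

Lemma fps_euler1 (R : realType) : fps_euler 1 = 0 :> fps R.
Proof. by rewrite -fpsC1 fps_eulerC. Qed.

Lemma fps_eulerZ (R : realType) : fps_euler (fpsZ R) = fpsZ R.
Proof. by apply/fpsP => -[|[|n]] /=; rewrite ?mul0r ?mulr0 ?mulr1. Qed.

(** The substitution of -z for z. *)
Definition fps_flip (R : realType) (f : fps R) := Fps (fun n => (-1) ^+ n * coef f n).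

Lemma fps_flipM (R : realType) (f g : fps R) :
  fps_flip (f * g) = fps_flip f * fps_flip g.
Proof.
apply/fpsP => n; rewrite !fcoefM /= mulr_sumr.
apply: eq_bigr => i _.
have -> : (-1) ^+ n = (-1) ^+ i * (-1) ^+ (n - i) :> R.
  by rewrite -exprD subnKC // -ltnS.
ring.
Qed.

Lemma fps_flipD (R : realType) (f g : fps R) :
  fps_flip (f + g) = fps_flip f + fps_flip g.
Proof. by apply/fpsP => n /=; rewrite mulrDr. Qed.

Lemma fps_flipN (R : realType) (f : fps R) : fps_flip (- f) = - fps_flip f.
Proof. by apply/fpsP => n /=; rewrite mulrN. Qed.

Lemma fps_flipC (R : realType) (c : R) : fps_flip (fpsC c) = fpsC c.
Proof. by apply/fpsP => -[|n] /=; rewrite ?expr0 ?mul1r ?mulr0. Qed.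

Lemma fps_flip1 (R : realType) : fps_flip 1 = 1 :> fps R.
Proof. by rewrite -fpsC1 fps_flipC. Qed.

Lemma fps_flipZ (R : realType) : fps_flip (fpsZ R) = - fpsZ R.
Proof.
by apply/fpsP => -[|[|n]]; rewrite fcoefN /= ?expr1 ?mulr1 ?mulr0 ?oppr0.
Qed.

Lemma fps_flip_euler (R : realType) (f : fps R) :
  fps_flip (fps_euler f) = fps_euler (fps_flip f).
Proof. by apply/fpsP => n /=; ring. Qed.

Lemma coef_exp_small (R : realType) (g : fps R) j n :
  coef g 0 = 0 -> (n < j)%N -> coef (g ^+ j) n = 0.
Proof.
move=> g0; elim: j n => [//|j ih] n nj; rewrite exprS fcoefM big1 // => -[[|i] /= lin] _.
  by rewrite g0 mul0r.
rewrite ih ?mulr0 //.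
by case: n nj lin => // n nj _; rewrite subSS (leq_ltn_trans (leq_subr _ _)).
Qed.

Lemma coef_sum (R : realType) I (r : seq I) (P : pred I) (F : I -> fps R) n :
  coef (\sum_(i <- r | P i) F i) n = \sum_(i <- r | P i) coef (F i) n.
Proof. exact: (big_morph (fun f => coef f n) (fun _ _ => erefl) erefl). Qed.

(** Geometric series in 1 - f, an inverse when the constant coefficient is 1: powers beyond n do not
    reach coefficient n. Each coefficient is thus a finite sum of powers, through which derivatives
    and limits pass. *)
Definition fps_inv (R : realType) (f : fps R) :=
  Fps (fun n => coef (\sum_(j < n.+1) (1 - f) ^+ j) n).

Lemma fps_mulV (R : realType) (f : fps R) : coef f 0 = 1 -> f * fps_inv f = 1.
Proof.
move=> f0; set g := 1 - f.
have g0 : coef g 0 = 0 by rewrite /g fcoefD fcoefN f0 fcoef1 subrr.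
have stab n N : (n < N)%N -> coef (fps_inv f) n = coef (\sum_(j < N) g ^+ j) n.
  move=> nN; rewrite /= -/g !coef_sum.
  rewrite (big_ord_widen _ (fun j => coef (g ^+ j) n) nN) big_mkcond /=.
  apply: eq_bigr => j _; case: ifPn => //; rewrite -leqNgt => nj.
  by rewrite coef_exp_small.
apply/fpsP => n.
have -> : coef (f * fps_inv f) n = coef (f * \sum_(j < n.+1) g ^+ j) n.
  rewrite !fcoefM; apply: eq_bigr => i _; congr (_ * _).
  by rewrite (stab _ n.+1) // ltnS leq_subr.
have fg : f * \sum_(j < n.+1) g ^+ j = 1 - g ^+ n.+1.
  have -> : f = 1 - g by rewrite /g opprB addrC subrK.
  rewrite -[X in X - g ^+ n.+1](expr1n _ n.+1) subrXX; congr (_ * _).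
  by apply: eq_bigr => i _; rewrite expr1n mul1r.
by rewrite fg fcoefD fcoefN coef_exp_small // subr0.
Qed.

(** * Primitives on the positive half-line *)

Section Primitives.
Context {R : realType}.
Implicit Types (f g F G : R -> R) (s u c : R).
Notation mu := (@lebesgue_measure R).

Lemma is_derive_continuous f s l : is_derive s 1 f l -> {for s, continuous f}.
Proof.
by move=> [+ _] => /derivable1_diffP /differentiable_continuous.
Qed.

Lemma is_derive_ext f g s l : (\forall t \near s, f t = g t) ->
  is_derive s 1 f l -> is_derive s 1 g l.
Proof. by move=> fg; apply: near_eq_is_derive => //; exact: oner_neq0. Qed.

Lemma derive0_pos_cst f :
  (forall s, 0 < s -> is_derive s 1 f 0) ->
  forall s u, 0 < s -> 0 < u -> f s = f u.
Proof.
move=> df.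
have key s u : 0 < s -> s <= u -> f s = f u.
  move=> s0 su; apply/esym/eqP; rewrite -subr_eq0; apply/eqP.
  have [||_ _] := @MVT_segment R f (fun=> 0) s u su; last by rewrite mul0r.
  - by move=> x; rewrite in_itv /= => /andP[sx _]; exact/df/(lt_trans s0).
  - apply: continuous_in_subspaceT => x; rewrite inE /= in_itv /= => /andP[sx _].
    exact/is_derive_continuous/df/(lt_le_trans s0).
move=> s u s0 u0.
by case: (leP s u) => [/(key _ _ s0)|/ltW /(key _ _ u0)].
Qed.

Lemma pos_continuous_within f c u : 0 < c ->
  (forall s, 0 < s -> {for s, continuous f}) -> {within `[c, u], continuous f}.
Proof.
move=> c0 cf; apply: continuous_in_subspaceT => x.
by rewrite inE /= in_itv /= => /andP[cx _]; exact/cf/(lt_le_trans c0).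
Qed.

Lemma pos_continuous_integrable f c u : 0 < c ->
  (forall s, 0 < s -> {for s, continuous f}) ->
  mu.-integrable `[c, u] (EFin \o f).
Proof.
move=> c0 cf; apply: continuous_compact_integrable.
  exact: segment_compact.
exact: pos_continuous_within.
Qed.

Lemma pos_continuous_FTC2 f F c u : 0 < c -> c <= u ->
  (forall s, 0 < s -> {for s, continuous f}) ->
  (forall s, 0 < s -> is_derive s 1 F (f s)) ->
  (\int[mu]_(x in `[c, u]) (f x)%:E = (F u - F c)%:E)%E.
Proof.
move=> c0; rewrite le_eqVlt => /predU1P[<- cf dF|cu cf dF].
  by rewrite set_itv1 integral_set1 subrr.
rewrite EFinB; apply: continuous_FTC2 => //.
- exact: pos_continuous_within.
- split.
  + move=> x; rewrite in_itv /= => /andP[cx _].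
    by have [] := dF _ (lt_trans c0 cx).
  + apply: cvg_at_right_filter; exact: (is_derive_continuous (dF _ c0)).
  + apply: cvg_at_left_filter.
    exact: (is_derive_continuous (dF _ (lt_trans c0 cu))).
- move=> x; rewrite in_itv /= => /andP[cx _].
  by rewrite derive1E; have [_] := dF _ (lt_trans c0 cx).
Qed.

Lemma is_derive_Rintegral f c s u : c < s -> s < u ->
  mu.-integrable `]c, u] (EFin \o f) -> {for s, continuous f} ->
  is_derive s 1 (fun x => \int[mu]_(t in `]c, x]) f t) (f s).
Proof.
move=> cs su fi fs.
have cs' : (BRight c < BRight s)%O by rewrite bnd_simp.
have [dF F'] := continuous_FTC1 su fi cs' fs.
by split=> //; rewrite -derive1E.
Qed.

Definition prim0 f s := \int[mu]_(t in `]0, s]) f t.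

(** The integrand may be singular at 0, so a bound is asked for on ]0, 1]; compactness bounds it on
    the rest. *)
Lemma integrable_prim0 f (M : R) u :
  (forall s, 0 < s -> {for s, continuous f}) ->
  (forall s, 0 < s -> s <= 1 -> `|f s| <= M) ->
  mu.-integrable `]0, u] (EFin \o f).
Proof.
move=> cf fM.
have mf : measurable_fun (`]0, +oo[ : set R) f.
  apply: open_continuous_measurable_fun; first exact: interval_open.
  by move=> x; rewrite inE /= in_itv /= andbT => /cf.
have [M' [_ fM']] : bounded_set (f @` `[1, Num.max 1 u]).
  apply: compact_bounded; apply: continuous_compact.
    exact: pos_continuous_within.
  exact: segment_compact.
apply: measurable_bounded_integrable => //.
- rewrite [ltLHS]lebesgue_measure_itv /=; case: ifPn => // _.
  by rewrite oppr0 adde0 ltry.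
- apply: measurable_funS mf => //.
  by move=> x /=; rewrite !in_itv /= => /andP[->].
- exists (Num.max M M'); split; first exact: num_real.
  move=> M0; rewrite gt_max => /andP[/ltW MM0 /fM' M'M0] x /=.
  rewrite in_itv /= => /andP[x0 xu]; case: (leP x 1) => x1.
    exact: le_trans (fM _ x0 x1) MM0.
  apply: M'M0; exists x => //=.
  by rewrite in_itv /= ltW // le_max xu orbT.
Qed.

End Primitives.

Section PrimitiveFunctions.
Context {R : realType}.
Implicit Types (f g F G : R -> R) (s u c : R).
Notation mu := (@lebesgue_measure R).

Lemma prim0_derive f (M : R) s :
  (forall s, 0 < s -> {for s, continuous f}) ->
  (forall s, 0 < s -> s <= 1 -> `|f s| <= M) ->
  0 < s -> is_derive s 1 (prim0 f) (f s).
Proof.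
move=> cf fM s0; apply: (@is_derive_Rintegral _ _ _ _ (s + 1)) => //.
- by rewrite ltrDl.
- exact: integrable_prim0 fM.
- exact: cf.
Qed.

Lemma Rintegral_expr m s : 0 < s ->
  \int[mu]_(t in `]0, s]) t ^+ m = s ^+ m.+1 / m.+1%:R.
Proof.
move=> s0.
have cX : continuous (fun t : R => t ^+ m) by move=> t; exact: exprn_continuous.
have iX : mu.-integrable `[0, s] (EFin \o (fun t : R => t ^+ m)).
  apply: continuous_compact_integrable; first exact: segment_compact.
  exact: continuous_subspaceT.
rewrite Rintegral_itv_obnd_cbnd; last first.
  apply: integrableS iX => //.
  by move=> x /=; rewrite !in_itv /= => /andP[/ltW -> ->].
pose F (t : R) := t ^+ m.+1 / m.+1%:R.
have dF (t : R) : is_derive t (1 : R) F (t ^+ m).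
  have -> : F = (m.+1%:R^-1 : R) *: ((id : R -> R) ^+ m.+1).
    by apply/funext => x; rewrite /F mulrC exprfctE.
  by apply: is_derive_eq; rewrite /GRing.scale /= mulr1 mulKf.
have -> : s ^+ m.+1 / m.+1%:R = F s - F 0.
  by rewrite /F expr0n /= mul0r subr0.
rewrite /Rintegral (@continuous_FTC2 R _ F) //.
- exact: continuous_subspaceT.
- split.
  + by move=> x _; have [] := dF x.
  + exact/cvg_at_right_filter/is_derive_continuous.
  + exact/cvg_at_left_filter/is_derive_continuous.
- by move=> x _; rewrite derive1E; have [_] := dF x.
Qed.

Lemma prim0_bound f (M : R) m s :
  (forall s, 0 < s -> {for s, continuous f}) ->
  (forall s, 0 < s -> s <= 1 -> `|f s| <= M * s ^+ m) ->
  0 < s -> s <= 1 -> `|prim0 f s| <= M * s ^+ m.+1 / m.+1%:R.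
Proof.
move=> cf fM s0 s1.
have M0 : 0 <= M.
  have := fM _ ltr01 (lexx _); rewrite expr1n mulr1.
  exact: le_trans.
have fi : mu.-integrable `]0, s] (EFin \o f).
  apply: (@integrable_prim0 _ _ M) => // t t0 t1.
  apply: le_trans (fM _ t0 t1) _.
  by rewrite ler_piMr // exprn_ile1 // ltW.
have Xi : mu.-integrable `]0, s] (EFin \o (fun t : R => t ^+ m)).
  apply: (@integrable_prim0 _ _ 1) => [t _|t t0 t1]; first exact: exprn_continuous.
  by rewrite ger0_norm ?exprn_ge0 ?exprn_ile1 // ltW.
apply: (@le_trans _ _ (\int[mu]_(t in `]0, s]) (M * t ^+ m))).
  apply: le_trans (le_normr_Rintegral _ fi) _ => //.
  apply: le_Rintegral => //.
  - by move/integrable_norm : fi.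
  - apply: (@integrable_prim0 _ _ M) => [t _|t t0 t1].
      by apply: cvgM; [exact: cvg_cst|exact: exprn_continuous].
    rewrite ger0_norm ?mulr_ge0 ?exprn_ge0 ?(ltW t0) //.
    by rewrite ler_piMr // exprn_ile1 // ltW.
  - move=> t /=; rewrite in_itv /= => /andP[t0 ts].
    by apply: fM => //; exact: le_trans ts s1.
by rewrite RintegralZl // Rintegral_expr // mulrA.
Qed.

(** The oriented integral from 1 to u, so that it is differentiable at every u > 0, in particular at
    the base point 1. *)
Definition prim1 f u := \int[mu]_(t in `]1, u]) f t - \int[mu]_(t in `]u, 1]) f t.

Lemma prim1_1 f : prim1 f 1 = 0.
Proof. by rewrite /prim1 subrr. Qed.

Lemma prim1_derive f u : (forall s, 0 < s -> {for s, continuous f}) ->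
  0 < u -> is_derive u 1 (prim1 f) (f u).
Proof.
(* A point below both u and 1: near u, [prim1] is the integral from c minus a constant, whichever
   side of 1 is meant. *)
move=> cf u0; pose c := Num.min u 1 / 2.
have c0 : 0 < c by rewrite divr_gt0 // lt_min u0 ltr01.
have cu : c < u.
  rewrite /c ltr_pdivrMr // (@le_lt_trans _ _ u) ?ge_min ?lexx //.
  by rewrite ltr_pMr // ltr1n.
have c1 : c < 1.
  rewrite /c ltr_pdivrMr // (@le_lt_trans _ _ 1) ?ge_min ?lexx ?orbT //.
  by rewrite mul1r ltr1n.
have fi v : mu.-integrable `]c, v] (EFin \o f).
  apply: integrableS (pos_continuous_integrable v c0 cf) => //.
  by move=> x /=; rewrite !in_itv /= => /andP[/ltW -> ->].
have key t : c < t -> \int[mu]_(x in `]c, t]) f x - \int[mu]_(x in `]c, 1]) f x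
    = prim1 f t.
  move=> ct; rewrite /prim1; case: (leP t 1) => t1.
    rewrite (@set_itv_ge _ _ (BRight 1)) ?bnd_simp -?leNgt //.
    rewrite Rintegral_set0 sub0r -opprB; congr (- _).
    by rewrite Rintegral_itvB ?bnd_simp ?(ltW ct).
  rewrite (@set_itv_ge _ _ (BRight t)) ?bnd_simp -?leNgt ?(ltW t1) //.
  by rewrite Rintegral_set0 subr0 Rintegral_itvB ?bnd_simp ?(ltW c1) ?(ltW t1).
apply: (@is_derive_ext _ (fun t => \int[mu]_(x in `]c, t]) f x -
                                   \int[mu]_(x in `]c, 1]) f x)).
  near=> t; apply: key; near: t; exact: lt_nbhsr.
apply: (@is_derive_eq _ _ _ _ _ _ _ (f u - 0)); last by rewrite subr0.
apply: is_deriveB.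
apply: (@is_derive_Rintegral _ _ _ _ (u + 1)) => //.
- by rewrite ltrDl.
- exact: cf.
Unshelve. all: by end_near. Qed.

End PrimitiveFunctions.

(** * Differentiable families of power series *)

Section Families.
Context {R : realType}.
Implicit Types (F G : R -> fps R) (s : R) (L : fps R).

Definition fps_derive F s L :=
  forall n, is_derive s 1 (fun t => coef (F t) n) (coef L n).

Lemma fps_derive_eq F s L L' : fps_derive F s L -> L = L' -> fps_derive F s L'.
Proof. by move=> dF <-. Qed.

Lemma fps_derive_unique F s L L' : fps_derive F s L -> fps_derive F s L' -> L = L'.
Proof.
move=> dF dF'; apply/fpsP => n.
by have [_ <-] := dF n; have [_ <-] := dF' n.
Qed.

Lemma fps_derive_cst L s : fps_derive (fun=> L) s 0.
Proof. by move=> n; exact: is_derive_cst. Qed.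

Lemma fps_deriveC (f : R -> R) (l : R) s : is_derive s 1 f l ->
  fps_derive (fun t => fpsC (f t)) s (fpsC l).
Proof. by move=> df [|n] //=; exact: is_derive_cst. Qed.

Lemma fps_deriveD F G s L L' : fps_derive F s L -> fps_derive G s L' ->
  fps_derive (fun t => F t + G t) s (L + L').
Proof. by move=> dF dG n; exact: is_deriveD. Qed.

Lemma fps_deriveN F s L : fps_derive F s L -> fps_derive (fun t => - F t) s (- L).
Proof. by move=> dF n; exact: is_deriveN. Qed.

Lemma fps_deriveB F G s L L' : fps_derive F s L -> fps_derive G s L' ->
  fps_derive (fun t => F t - G t) s (L - L').
Proof. by move=> dF dG; apply: fps_deriveD => //; exact: fps_deriveN. Qed.

Lemma fps_deriveM F G s L L' : fps_derive F s L -> fps_derive G s L' ->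
  fps_derive (fun t => F t * G t) s (L * G s + F s * L').
Proof.
move=> dF dG n.
have -> : (fun t => coef (F t * G t) n) =
    \sum_(i < n.+1) (fun t => coef (F t) i * coef (G t) (n - i)%N).
  by apply/funext => t; rewrite fct_sumE.
apply: is_derive_eq; first by apply: is_derive_sum => i; exact: is_deriveM.
rewrite fcoefD !fcoefM -big_split /=; apply: eq_bigr => i _.
by rewrite /GRing.scale /= addrC mulrC [in RHS]mulrC; congr (_ + _); rewrite mulrC.
Qed.

Lemma fps_derive_euler F s L : fps_derive F s L ->
  fps_derive (fun t => fps_euler (F t)) s (fps_euler L).
Proof. by move=> dF n; exact: (is_deriveZ n%:R (dF n)). Qed.

Lemma fps_derive_flip F s L : fps_derive F s L ->
  fps_derive (fun t => fps_flip (F t)) s (fps_flip L).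
Proof. by move=> dF n; exact: (is_deriveZ ((-1) ^+ n) (dF n)). Qed.

(** Existence suffices: the value is recovered later by differentiating F * F^-1 = 1. *)
Lemma fps_derivable_inv F s L : fps_derive F s L ->
  exists L', fps_derive (fun t => fps_inv (F t)) s L'.
Proof.
move=> dF.
have dX j : exists L', fps_derive (fun t => (1 - F t) ^+ j) s L'.
  elim: j => [|j [L' ih]].
    by exists 0; apply: fps_derive_cst.
  exists ((0 - L) * (1 - F s) ^+ j + (1 - F s) * L').
  have -> : (fun t => (1 - F t) ^+ j.+1) = (fun t => (1 - F t) * (1 - F t) ^+ j).
    by apply/funext => t; rewrite exprS.
  by apply: fps_deriveM => //; apply: fps_deriveB => //; exact: fps_derive_cst.
pose L' j := sval (cid (dX j)).
have dL' j : fps_derive (fun t => (1 - F t) ^+ j) s (L' j) := svalP (cid (dX j)).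
exists (Fps (fun n => \sum_(j < n.+1) coef (L' j) n)) => n /=.
have -> : (fun t => coef (\sum_(j < n.+1) (1 - F t) ^+ j) n) =
    \sum_(j < n.+1) (fun t => coef ((1 - F t) ^+ j) n).
  by apply/funext => t; rewrite fct_sumE coef_sum.
by apply: is_derive_sum => j; exact: dL'.
Qed.

Definition fps_lim0 F L := forall n, coef (F t) n @[t --> 0^'+] --> coef L n.

Lemma fps_lim0_cst L : fps_lim0 (fun=> L) L.
Proof. by move=> n; exact: cvg_cst. Qed.

Lemma fps_lim0D F G L L' : fps_lim0 F L -> fps_lim0 G L' ->
  fps_lim0 (fun t => F t + G t) (L + L').
Proof. by move=> lF lG n; exact: cvgD. Qed.

Lemma fps_lim0N F L : fps_lim0 F L -> fps_lim0 (fun t => - F t) (- L).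
Proof. by move=> lF n; exact: cvgN. Qed.

Lemma fps_lim0B F G L L' : fps_lim0 F L -> fps_lim0 G L' ->
  fps_lim0 (fun t => F t - G t) (L - L').
Proof. by move=> lF lG; apply: fps_lim0D => //; exact: fps_lim0N. Qed.

Lemma fps_lim0M F G L L' : fps_lim0 F L -> fps_lim0 G L' ->
  fps_lim0 (fun t => F t * G t) (L * L').
Proof.
move=> lF lG n; apply: cvg_big => [|i _]; [exact: add_continuous|]; exact: cvgM.
Qed.

Lemma fps_lim0_euler F L : fps_lim0 F L ->
  fps_lim0 (fun t => fps_euler (F t)) (fps_euler L).
Proof. by move=> lF n; apply: cvgM => //; exact: cvg_cst. Qed.

Lemma fps_lim0_flip F L : fps_lim0 F L ->
  fps_lim0 (fun t => fps_flip (F t)) (fps_flip L).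
Proof. by move=> lF n; apply: cvgM => //; exact: cvg_cst. Qed.

Lemma fps_lim0C (f : R -> R) (l : R) : f t @[t --> 0^'+] --> l ->
  fps_lim0 (fun t => fpsC (f t)) (fpsC l).
Proof. by move=> lf [|n] //=; exact: cvg_cst. Qed.

Lemma fps_lim0_inv F L : fps_lim0 F L ->
  fps_lim0 (fun t => fps_inv (F t)) (fps_inv L).
Proof.
move=> lF n /=.
have lX j : fps_lim0 (fun t => (1 - F t) ^+ j) ((1 - L) ^+ j).
  elim: j => [|j ih]; first exact: fps_lim0_cst.
  rewrite exprS.
  have -> : (fun t => (1 - F t) ^+ j.+1) = (fun t => (1 - F t) * (1 - F t) ^+ j).
    by apply/funext => t; rewrite exprS.
  by apply: fps_lim0M => //; apply: fps_lim0B => //; exact: fps_lim0_cst.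
under eq_fun do rewrite coef_sum.
by rewrite coef_sum; apply: cvg_big => [|j _]; [exact: add_continuous|]; exact: lX.
Qed.

Lemma pos_derive0_lim (f : R -> R) (l : R) :
  (forall s, 0 < s -> is_derive s 1 f 0) -> f t @[t --> 0^'+] --> l ->
  forall s, 0 < s -> f s = l.
Proof.
move=> df lf s s0; apply: (cvg_unique _ _ lf) => //.
apply: (@cvg_trans _ ((fun=> f s) @ 0^'+)); last exact: cvg_cst.
apply: near_eq_cvg; near=> t.
by rewrite (derive0_pos_cst df (s := s) (u := t)).
Unshelve. all: by end_near. Qed.

Lemma fps_derive0_lim F L : (forall s, 0 < s -> fps_derive F s 0) ->
  fps_lim0 F L -> forall s, 0 < s -> F s = L.
Proof.
move=> dF lF s s0; apply/fpsP => n.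
by apply: (@pos_derive0_lim (fun t => coef (F t) n)) => // t t0; exact: dF.
Qed.

End Families.

(** * The linear system and its contiguity relation *)

Section Ode.
Context {R : realType}.
Implicit Types (X Y : R -> fps R) (s : R) (a d : nat).

Definition kw a d (t : R) := t ^+ d.-1 / (1 + t ^+ a).
(* For t > 0 this is t^(a-d-1)/(1+t^a), written so that d >= a is allowed. *)
Definition kv a d (t : R) := t ^+ a / t ^+ d.+1 / (1 + t ^+ a).

Lemma kernel_den_gt0 a (t : R) : 0 < t -> 0 < 1 + t ^+ a.
Proof. by move=> t0; rewrite addr_gt0 // exprn_gt0. Qed.

Lemma kw_ge0 a d (t : R) : 0 < t -> 0 <= kw a d t.
Proof.
move=> t0; apply: divr_ge0; first by rewrite exprn_ge0 // ltW.
by rewrite ltW // kernel_den_gt0.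
Qed.

Lemma kw_le a d (t : R) : 0 < t -> kw a d t <= t ^+ d.-1.
Proof.
move=> t0; rewrite /kw ler_pdivrMr ?kernel_den_gt0 //.
by rewrite ler_peMr ?exprn_ge0 ?(ltW t0) // lerDl exprn_ge0 // ltW.
Qed.

Lemma kv_ge0 a d (t : R) : 0 < t -> 0 <= kv a d t.
Proof.
move=> t0; rewrite !divr_ge0 ?exprn_ge0 ?(ltW t0) //.
by rewrite ltW // kernel_den_gt0.
Qed.

Lemma kv_le a d (t : R) : 0 < t -> kv a d t <= t ^+ a / t ^+ d.+1.
Proof.
move=> t0; rewrite /kv ler_pdivrMr ?kernel_den_gt0 //.
rewrite ler_peMr ?divr_ge0 ?exprn_ge0 ?(ltW t0) //.
by rewrite lerDl exprn_ge0 // ltW.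
Qed.

Lemma kw_continuous a d (t : R) : 0 < t -> {for t, continuous (kw a d)}.
Proof.
move=> t0; apply: cvgM; first exact: exprn_continuous.
apply: cvgV; first by rewrite gt_eqF // kernel_den_gt0.
by apply: cvgD; [exact: cvg_cst|exact: exprn_continuous].
Qed.

Lemma kv_continuous a d (t : R) : 0 < t -> {for t, continuous (kv a d)}.
Proof.
move=> t0; apply: cvgM; last first.
  apply: cvgV; first by rewrite gt_eqF // kernel_den_gt0.
  by apply: cvgD; [exact: cvg_cst|exact: exprn_continuous].
apply: cvgM; first exact: exprn_continuous.
by apply: cvgV; [rewrite gt_eqF // exprn_gt0|exact: exprn_continuous].
Qed.

(* Coefficients in z of the solution of X' = - z kv Y, Y' = z kw X with value
   (1, 0) at 0, by Picard iteration. *)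
Fixpoint ode_coef a d n : (R -> R) * (R -> R) :=
  if n is n'.+1 then
    (fun s => - prim0 (fun t => kv a d t * (ode_coef a d n').2 t) s,
     fun s => prim0 (fun t => kw a d t * (ode_coef a d n').1 t) s)
  else (fun=> 1, fun=> 0).

Definition odeX a d s := Fps (fun n => (ode_coef a d n).1 s).
Definition odeY a d s := Fps (fun n => (ode_coef a d n).2 s).

(** The induction carries the derivatives, which give continuity, together with the orders at 0. The
    order d of Y compensates the singularity of [kv]: the product is O(s^(a-1)) even when d >= a. *)
Lemma ode_coef_spec a d n : (0 < a)%N -> (0 < d)%N ->
  [/\ forall s, 0 < s -> is_derive s 1 (fun t => coef (odeX a d t) n)
        (coef (- (fpsZ R * (fpsC (kv a d s) * odeY a d s))) n),
      forall s, 0 < s -> is_derive s 1 (fun t => coef (odeY a d t) n)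
        (coef (fpsZ R * (fpsC (kw a d s) * odeX a d s)) n),
      forall s, 0 < s -> s <= 1 ->
        `|coef (odeX a d s) n| <= if n is 0 then 1 else s ^+ a / d%:R &
      forall s, 0 < s -> s <= 1 -> `|coef (odeY a d s) n| <= s ^+ d / d%:R].
Proof.
move=> a0 d0; elim: n => [|n [dX dY bX bY]].
  split => s s0.
  - by rewrite fcoefN fcoefZM oppr0; exact: is_derive_cst.
  - by rewrite fcoefZM; exact: is_derive_cst.
  - by rewrite normr1.
  - by move=> _; rewrite normr0 divr_ge0 // exprn_ge0 // ltW.
have cX s : 0 < s -> {for s, continuous (ode_coef a d n).1}.
  by move=> s0; exact: is_derive_continuous (dX s s0).
have cY s : 0 < s -> {for s, continuous (ode_coef a d n).2}.
  by move=> s0; exact: is_derive_continuous (dY s s0).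
have bX1 s : 0 < s -> s <= 1 -> `|(ode_coef a d n).1 s| <= 1.
  move=> s0 s1; apply: le_trans (bX s s0 s1) _; case: (n) => // _.
  rewrite ler_pdivrMr ?ltr0n // mul1r (le_trans (exprn_ile1 a (ltW s0) s1)) //.
  by rewrite -[1]/(1%:R) ler_nat.
pose f t := kv a d t * (ode_coef a d n).2 t.
pose g t := kw a d t * (ode_coef a d n).1 t.
have cf s : 0 < s -> {for s, continuous f}.
  by move=> s0; apply: cvgM; [exact: kv_continuous|exact: cY].
have cg s : 0 < s -> {for s, continuous g}.
  by move=> s0; apply: cvgM; [exact: kw_continuous|exact: cX].
have bf s : 0 < s -> s <= 1 -> `|f s| <= d%:R^-1 * s ^+ a.-1.
  move=> s0 s1; rewrite normrM ger0_norm ?kv_ge0 //.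
  apply: le_trans (ler_pM _ _ (kv_le a d s0) (bY s s0 s1)) _ => //.
    exact: kv_ge0.
  rewrite -[in s ^+ a](prednK a0) !exprS le_eqVlt; apply/orP; left; apply/eqP.
  have sn : s != 0 by rewrite gt_eqF.
  have sdn : s ^+ d != 0 by rewrite expf_neq0.
  field.
  by rewrite sn sdn pnatr_eq0 -lt0n d0.
have bg s : 0 < s -> s <= 1 -> `|g s| <= 1 * s ^+ d.-1.
  move=> s0 s1; rewrite normrM ger0_norm ?kw_ge0 // mulrC.
  by apply: ler_pM; rewrite ?normr_ge0 ?kw_ge0 ?kw_le ?bX1.
split => s s0.
- rewrite fcoefN fcoefZM fcoefCM; apply: is_deriveN.
  apply: (prim0_derive (M := d%:R^-1)) => // t t0 t1.
  by apply: le_trans (bf _ t0 t1) _; rewrite ler_piMr ?invr_ge0 // exprn_ile1 // ltW.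
- rewrite fcoefZM fcoefCM.
  apply: (prim0_derive (M := 1)) => // t t0 t1.
  by apply: le_trans (bg _ t0 t1) _; rewrite mul1r exprn_ile1 // ltW.
- move=> s1; rewrite /= normrN.
  apply: le_trans (prim0_bound cf bf s0 s1) _.
  rewrite (prednK a0) [leRHS]mulrC.
  rewrite ler_pdivrMr ?ltr0n // ler_peMr ?mulr_ge0 ?invr_ge0 ?exprn_ge0 ?(ltW s0) //.
  by rewrite -[1]/(1%:R) ler_nat.
- move=> s1; apply: le_trans (prim0_bound cg bg s0 s1) _.
  by rewrite (prednK d0) mul1r.
Qed.

End Ode.

Section Contiguity.
Context {R : realType}.
Implicit Types (X Y : R -> fps R) (s : R) (a d : nat).

Lemma cvg0_linear_bound (f : R -> R) (C : R) :
  (forall s, 0 < s -> s <= 1 -> `|f s| <= C * s) -> f s @[s --> 0^'+] --> 0.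
Proof.
move=> fC.
have lC : C * s @[s --> 0^'+] --> 0.
  rewrite -[X in _ --> X](mulr0 C); apply: cvgM; first exact: cvg_cst.
  exact: cvg_at_right_filter.
apply: (@squeeze_cvgr _ _ _ _ (fun s => - (C * s)) (fun s => C * s)) => //.
  near=> s; rewrite -ler_norml; apply: fC => //.
  by near: s; apply: nbhs_right_le.
by rewrite -[X in _ --> X]oppr0; exact: cvgN.
Unshelve. all: by end_near. Qed.

Lemma expr_div_le m d s : (0 < m)%N -> (0 < d)%N -> 0 < s -> s <= 1 ->
  s ^+ m / d%:R <= 1 * s.
Proof.
move=> m0 d0 s0 s1; rewrite mul1r ler_pdivrMr ?ltr0n //.
rewrite -(prednK m0) exprS ler_wpM2l ?(ltW s0) //.
by rewrite (le_trans (exprn_ile1 _ (ltW s0) s1)) // -[1]/(1%:R) ler_nat.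
Qed.

Lemma odeX_derive a d s : (0 < a)%N -> (0 < d)%N -> 0 < s ->
  fps_derive (odeX a d) s (- (fpsZ R * (fpsC (kv a d s) * odeY a d s))).
Proof. by move=> a0 d0 s0 n; have [dX _ _ _] := @ode_coef_spec R a d n a0 d0; exact: dX. Qed.

Lemma odeY_derive a d s : (0 < a)%N -> (0 < d)%N -> 0 < s ->
  fps_derive (odeY a d) s (fpsZ R * (fpsC (kw a d s) * odeX a d s)).
Proof. by move=> a0 d0 s0 n; have [_ dY _ _] := @ode_coef_spec R a d n a0 d0; exact: dY. Qed.

Lemma odeX_lim0 a d : (0 < a)%N -> (0 < d)%N -> fps_lim0 (odeX (R := R) a d) 1.
Proof.
move=> a0 d0 [|n]; first exact: cvg_cst.
apply: (@cvg0_linear_bound _ 1) => s s0 s1.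
have [_ _ bX _] := @ode_coef_spec R a d n.+1 a0 d0.
by apply: le_trans (bX s s0 s1) _; exact: expr_div_le.
Qed.

(** Used with d + a for d and d for e, to kill the singular coefficient s^(-d)/d of the contiguity
    relation at 0. *)
Lemma odeY_lim0_div a d e : (0 < a)%N -> (e < d)%N ->
  fps_lim0 (fun s : R => fpsC (s ^- e) * odeY a d s) 0.
Proof.
move=> a0 ed n; have d0 : (0 < d)%N by exact: leq_ltn_trans ed.
apply: (@cvg0_linear_bound _ 1) => s s0 s1.
have [_ _ _ bY] := @ode_coef_spec R a d n a0 d0.
rewrite fcoefCM normrM ger0_norm ?invr_ge0 ?exprn_ge0 ?(ltW s0) //.
apply: le_trans (ler_wpM2l _ (bY s s0 s1)) _.
  by rewrite invr_ge0 exprn_ge0 // ltW.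
have -> : s ^- e * (s ^+ d / d%:R) = s ^+ (d - e) / d%:R.
  rewrite -{1}(subnK (ltnW ed)) exprD mulrA [s ^- e * _]mulrC mulfK //.
  by rewrite expf_neq0 // gt_eqF.
by apply: expr_div_le => //; rewrite subn_gt0.
Qed.

Lemma odeY_lim0 a d : (0 < a)%N -> (0 < d)%N -> fps_lim0 (odeY (R := R) a d) 0.
Proof.
move=> a0 d0; have := odeY_lim0_div a0 d0.
have -> // : (fun s : R => fpsC (s ^- 0) * odeY a d s) = odeY a d.
by apply/funext => s; rewrite expr0 invr1 fpsC1 mul1r.
Qed.

(** Because of the factor z, the derivative of coefficient n + 1 involves only coefficient n, which
    vanishes by induction; so coefficient n + 1 is constant, equal to its limit 0. *)
Lemma ode_zero (p q : R -> R) X Y :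
  (forall s, 0 < s -> fps_derive X s (- (fpsZ R * (fpsC (p s) * Y s)))) ->
  (forall s, 0 < s -> fps_derive Y s (fpsZ R * (fpsC (q s) * X s))) ->
  fps_lim0 X 0 -> fps_lim0 Y 0 ->
  forall s, 0 < s -> X s = 0 /\ Y s = 0.
Proof.
move=> dX dY lX lY.
suff key n : forall s, 0 < s -> coef (X s) n = 0 /\ coef (Y s) n = 0.
  by move=> s s0; split; apply/fpsP => n; have [] := key n s s0.
elim: n => [|n ih] s s0; split.
- apply: (@pos_derive0_lim _ (fun t => coef (X t) 0)) => // t t0.
  by apply: is_derive_eq (dX t t0 0%N) _; rewrite fcoefN fcoefZM oppr0.
- apply: (@pos_derive0_lim _ (fun t => coef (Y t) 0)) => // t t0.
  by apply: is_derive_eq (dY t t0 0%N) _; rewrite fcoefZM.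
- apply: (@pos_derive0_lim _ (fun t => coef (X t) n.+1)) => // t t0.
  apply: is_derive_eq (dX t t0 n.+1) _; rewrite fcoefN fcoefZM fcoefCM.
  by have [_ ->] := ih t t0; rewrite mulr0 oppr0.
- apply: (@pos_derive0_lim _ (fun t => coef (Y t) n.+1)) => // t t0.
  apply: is_derive_eq (dY t t0 n.+1) _; rewrite fcoefZM fcoefCM.
  by have [-> _] := ih t t0; rewrite mulr0.
Qed.

Lemma ode_unique (p q : R -> R) X Y X' Y' L L' :
  (forall s, 0 < s -> fps_derive X s (- (fpsZ R * (fpsC (p s) * Y s)))) ->
  (forall s, 0 < s -> fps_derive Y s (fpsZ R * (fpsC (q s) * X s))) ->
  (forall s, 0 < s -> fps_derive X' s (- (fpsZ R * (fpsC (p s) * Y' s)))) ->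
  (forall s, 0 < s -> fps_derive Y' s (fpsZ R * (fpsC (q s) * X' s))) ->
  fps_lim0 X L -> fps_lim0 Y L' -> fps_lim0 X' L -> fps_lim0 Y' L' ->
  forall s, 0 < s -> X s = X' s /\ Y s = Y' s.
Proof.
move=> dX dY dX' dY' lX lY lX' lY' s s0.
have [] := @ode_zero p q (fun t => X t - X' t) (fun t => Y t - Y' t) _ _ _ _ s s0.
- move=> t t0; apply: fps_derive_eq (fps_deriveB (dX t t0) (dX' t t0)) _; ring.
- move=> t t0; apply: fps_derive_eq (fps_deriveB (dY t t0) (dY' t t0)) _; ring.
- by rewrite -(subrr L); exact: fps_lim0B.
- by rewrite -(subrr L'); exact: fps_lim0B.
by move=> /eqP; rewrite subr_eq0 => /eqP -> /eqP; rewrite subr_eq0 => /eqP ->.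
Qed.

Lemma is_derive_exprV d s : s != 0 ->
  is_derive s 1 (fun t : R => t ^- d / d%:R) (if d is 0 then 0 else - s ^- d.+1).
Proof.
(* For d = 0 the function is constantly 0, since division by 0 yields 0. *)
case: d => [|d] s0.
  have -> : (fun t : R => t ^- 0 / 0%:R) = cst 0.
    by apply/funext => t; rewrite /= invr0 mulr0.
  exact: is_derive_cst.
have -> : (fun t : R => t ^- d.+1 / d.+1%:R) =
    (d.+1%:R^-1 : R) *: (fun t => (((id : R -> R) ^+ d.+1) t)^-1).
  by apply/funext => t; rewrite mulrC exprfctE.
apply: is_derive_eq.
  apply: is_deriveZ; apply: is_deriveV.
  by rewrite exprfctE expf_neq0.
rewrite /GRing.scale /= exprfctE /= mulr1 -!exprM.
have sd : s ^+ d != 0 by rewrite expf_neq0.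
rewrite muln2 -addnn exprD exprS [s ^+ d.+2]exprS exprS.
by field; rewrite s0 sd nat1r pnatr_eq0.
Qed.

Lemma is_derive_expr d s : (0 < d)%N ->
  is_derive s 1 (fun t : R => t ^+ d / d%:R) (s ^+ d.-1).
Proof.
case: d => // d _.
have -> : (fun t : R => t ^+ d.+1 / d.+1%:R) =
    (d.+1%:R^-1 : R) *: ((id : R -> R) ^+ d.+1).
  by apply/funext => x; rewrite mulrC exprfctE.
by apply: is_derive_eq; rewrite /GRing.scale /= mulr1 mulKf.
Qed.

(** Both sides solve the same system with the same limits at 0. The added terms are the primitives
    of w_d + w_(d+a) = s^(d-1) and of v_d + v_(d+a) = s^(-d-1), up to sign. *)
Lemma ode_contiguity a d s : (0 < a)%N -> (0 < d)%N -> 0 < s ->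
  odeX a d s = fps_flip (odeX a (d + a) s) +
    fpsZ R * (fpsC (s ^- d / d%:R) * fps_flip (odeY a (d + a) s)) /\
  odeY a d s = fps_flip (odeY a (d + a) s) +
    fpsZ R * (fpsC (s ^+ d / d%:R) * fps_flip (odeX a (d + a) s)).
Proof.
move=> a0 d0; have da0 : (0 < d + a)%N by rewrite addn_gt0 d0.
move: s; apply: (@ode_unique (kv a d) (kw a d) _ _ _ _ 1 0).
- by move=> s s0; exact: odeX_derive.
- by move=> s s0; exact: odeY_derive.
- move=> s s0; have sn : s != 0 by rewrite gt_eqF.
  have dsX := fps_derive_flip (odeX_derive a0 da0 s0).
  have dsY := fps_derive_flip (odeY_derive a0 da0 s0).
  have dC := fps_deriveC (is_derive_exprV d sn).
  have := fps_deriveD dsX (fps_deriveM (fps_derive_cst (fpsZ R) s) (fps_deriveM dC dsY)).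
  move=> /fps_derive_eq; apply.
  rewrite !(fps_flipN, fps_flipM, fps_flipC, fps_flipZ).
  have -> : (if d is 0 then 0 else - s ^- d.+1) = - s ^- d.+1 by case: (d) d0.
  (* [k1] matches the terms linear in z, [k2] the quadratic ones; likewise in the second equation
     below. *)
  have k1 : - s ^- d.+1 = - kv a d s - kv a (d + a) s.
    have den : 1 + s ^+ a != 0 by rewrite gt_eqF // kernel_den_gt0.
    rewrite /kv -addSn exprD.
    have sa : s ^+ a != 0 by rewrite expf_neq0.
    have sd : s ^+ d.+1 != 0 by rewrite expf_neq0.
    by field; rewrite sa sd den.
  have k2 : s ^- d / d%:R * kw a (d + a) s = kv a d s * (s ^+ d / d%:R).
    have den : 1 + s ^+ a != 0 by rewrite gt_eqF // kernel_den_gt0.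
    have pa : s ^+ a = s * s ^+ a.-1 by rewrite -exprS prednK.
    have pd : s ^+ (d + a).-1 = s ^+ d * s ^+ a.-1.
      by rewrite -exprD -{1}(prednK a0) addnS.
    rewrite /kv /kw pd exprS pa; rewrite pa in den.
    have sd : s ^+ d != 0 by rewrite expf_neq0.
    by field; rewrite sn sd den pnatr_eq0 -lt0n d0.
  rewrite k1 fpsCD !fpsCN.
  move/(congr1 (@fpsC R)): k2; rewrite [LHS]fpsCM [RHS]fpsCM => /eqP k2.
  apply/eqP; rewrite -subr_eq0; move: k2; rewrite -subr_eq0 => /eqP k2.
  set sX := fps_flip (odeX _ _ _); set sY := fps_flip (odeY _ _ _).
  apply/eqP; transitivity ((fpsC (s ^- d / d%:R) * fpsC (kw a (d + a) s) -
    fpsC (kv a d s) * fpsC (s ^+ d / d%:R)) * (- (fpsZ R * fpsZ R) * sX)); last first.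
    by rewrite k2 mul0r.
  ring.
- move=> s s0; have sn : s != 0 by rewrite gt_eqF.
  have dsX := fps_derive_flip (odeX_derive a0 da0 s0).
  have dsY := fps_derive_flip (odeY_derive a0 da0 s0).
  have dC := fps_deriveC (is_derive_expr s d0).
  have := fps_deriveD dsY (fps_deriveM (fps_derive_cst (fpsZ R) s) (fps_deriveM dC dsX)).
  move=> /fps_derive_eq; apply.
  rewrite !(fps_flipN, fps_flipM, fps_flipC, fps_flipZ).
  have k1 : s ^+ d.-1 = kw a d s + kw a (d + a) s.
    have den : 1 + s ^+ a != 0 by rewrite gt_eqF // kernel_den_gt0.
    have pd : s ^+ (d + a).-1 = s ^+ d.-1 * s ^+ a.
      by rewrite -exprD -{1}(prednK d0) addSn.
    rewrite /kw pd.
    by field; rewrite den.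
  have k2 : s ^+ d / d%:R * kv a (d + a) s = kw a d s * (s ^- d / d%:R).
    have den : 1 + s ^+ a != 0 by rewrite gt_eqF // kernel_den_gt0.
    rewrite /kv /kw -addSn exprD exprS.
    have sa : s ^+ a != 0 by rewrite expf_neq0.
    have sd : s ^+ d.-1 != 0 by rewrite expf_neq0.
    have -> : s ^+ d = s * s ^+ d.-1 by rewrite -exprS prednK.
    by field; rewrite sn sa sd den pnatr_eq0 -lt0n d0.
  rewrite k1 fpsCD.
  move/(congr1 (@fpsC R)): k2; rewrite [LHS]fpsCM [RHS]fpsCM => /eqP k2.
  apply/eqP; rewrite -subr_eq0; move: k2; rewrite -subr_eq0 => /eqP k2.
  set sX := fps_flip (odeX _ _ _); set sY := fps_flip (odeY _ _ _).
  apply/eqP; transitivity ((fpsC (s ^+ d / d%:R) * fpsC (kv a (d + a) s) -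
    fpsC (kw a d s) * fpsC (s ^- d / d%:R)) * ((fpsZ R * fpsZ R) * sY)); last first.
    by rewrite k2 mul0r.
  ring.
- exact: odeX_lim0.
- exact: odeY_lim0.
- have ed : (d < d + a)%N by rewrite -{1}[d]addn0 ltn_add2l.
  have -> : (fun s => fps_flip (odeX a (d + a) s) +
      fpsZ R * (fpsC (s ^- d / d%:R) * fps_flip (odeY a (d + a) s))) =
      (fun s => fps_flip (odeX a (d + a) s) +
      fpsZ R * (fpsC (d%:R^-1) * fps_flip (fpsC (s ^- d) * odeY a (d + a) s))).
    apply/funext => s; rewrite fps_flipM fps_flipC fpsCM; ring.
  have := fps_lim0D (fps_lim0_flip (odeX_lim0 a0 da0))
    (fps_lim0M (@fps_lim0_cst R (fpsZ R)) (fps_lim0M (@fps_lim0_cst R (fpsC d%:R^-1))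
      (fps_lim0_flip (odeY_lim0_div a0 ed)))).
  by rewrite -fpsC0 fps_flipC fps_flip1 fpsC0 !mulr0 addr0.
- have lC : fps_lim0 (fun s : R => fpsC (s ^+ d / d%:R)) (fpsC 0).
    apply: fps_lim0C; apply: (@cvg0_linear_bound _ 1) => s s0 s1.
    rewrite ger0_norm ?expr_div_le //.
    by rewrite divr_ge0 // exprn_ge0 // ltW.
  have := fps_lim0D (fps_lim0_flip (odeY_lim0 a0 da0))
    (fps_lim0M (@fps_lim0_cst R (fpsZ R)) (fps_lim0M lC
      (fps_lim0_flip (odeX_lim0 a0 da0)))).
  by rewrite -{1}fpsC0 fps_flipC fpsC0 mul0r mulr0 addr0.
Qed.

End Contiguity.

(** * Summing the series *)

Section PowerSums.
Context {R : realType}.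
Implicit Types (a d k n : nat).

Definition odeD a d : fps R := odeX a d 1 - odeY a d 1.
Definition odeC a d : fps R := - fps_euler (odeD a d) * fps_inv (odeD a d).

Lemma coef_odeD0 a d : coef (odeD a d) 0 = 1.
Proof. by rewrite fcoefD fcoefN /= subr0. Qed.

Lemma odeC_M a d : odeC a d * odeD a d = - fps_euler (odeD a d).
Proof.
by rewrite /odeC -mulrA [fps_inv _ * _]mulrC fps_mulV ?coef_odeD0 // mulr1.
Qed.

(** At s = 1 the powers s^d and s^(-d) are both 1, so the difference X - Y reproduces itself up to a
    factor. *)
Lemma odeD_contiguity a d : (0 < a)%N -> (0 < d)%N ->
  odeD a d = (1 - fpsZ R * fpsC d%:R^-1) * fps_flip (odeD a (d + a)).
Proof.
move=> a0 d0; rewrite /odeD; have [-> ->] := ode_contiguity a0 d0 (@ltr01 R).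
rewrite !expr1n invr1 div1r fps_flipD fps_flipN; ring.
Qed.

Lemma odeC_rec a d k : (0 < a)%N -> (0 < d)%N -> (0 < k)%N ->
  coef (odeC a d) k = d%:R ^- k + (-1) ^+ k * coef (odeC a (d + a)) k.
Proof.
move=> a0 d0 k0; set c := fpsC (d%:R^-1 : R).
(* The geometric series (z/d) / (1 - z/d), that is - z f'/f for f = 1 - z/d; a logarithmic
   derivative turns the contiguity product into a sum. *)
pose G := Fps (fun n => if n is 0 then 0 else d%:R ^- n : R).
have Gc : G * (1 - fpsZ R * c) = fpsZ R * c.
  rewrite mulrBr mulr1 mulrC -mulrA mulrC.
  rewrite [c * G * _]mulrC; apply/fpsP => -[|[|n]];
    rewrite fcoefD fcoefN !fcoefZM ?fcoefCM /= ?subr0 //.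
    by rewrite mulr0 subr0 expr1.
  by rewrite exprS invfM subrr.
suff -> : odeC a d = G + fps_flip (odeC a (d + a)).
  by rewrite fcoefD /=; case: k k0.
apply: (@fps_mulI _ (odeD a d)); first exact: coef_odeD0.
rewrite mulrC odeC_M mulrC.
have /(congr1 (@fps_flip R)) := odeC_M a (d + a).
rewrite fps_flipN fps_flipM fps_flip_euler => hC.
rewrite odeD_contiguity // -/c.
set D := fps_flip (odeD _ _) in hC *; set C := fps_flip (odeC _ _) in hC *.
rewrite fps_eulerM fps_eulerD fps_eulerN fps_euler1 fps_eulerM fps_eulerZ.
rewrite fps_eulerC mulr0 addr0 add0r.
transitivity (G * (1 - fpsZ R * c) * D + (1 - fpsZ R * c) * (C * D)); last by ring.
by rewrite Gc hC; ring.
Qed.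

Lemma coef_odeD_bound a d n : (0 < a)%N -> (0 < d)%N ->
  `|coef (odeD a d) n.+1| <= 2 / d%:R.
Proof.
move=> a0 d0; have [_ _ bX bY] := @ode_coef_spec R a d n.+1 a0 d0.
rewrite fcoefD fcoefN (le_trans (ler_normB _ _)) //.
have := lerD (bX 1 ltr01 (lexx _)) (bY 1 ltr01 (lexx _)).
by rewrite !expr1n -mulrDl.
Qed.

(** The constant depends on n but not on d: all coefficients of D_d past the first are O(1/d), and
    Newton's recursion propagates this to C. *)
Lemma coef_odeC_bound a n : (0 < a)%N ->
  exists2 K : R, 0 <= K & forall d, (0 < d)%N -> `|coef (odeC a d) n| <= K / d%:R.
Proof.
move=> a0; elim/ltn_ind: n => n ih.
(* Stated for every i, with the dummy bound 0 when i >= n, so that the constants can be chosen as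
   one function of i. *)
have ih' i : exists2 K : R, 0 <= K & (i < n)%N -> forall d, (0 < d)%N ->
    `|coef (odeC a d) i| <= K / d%:R.
  case: (ltnP i n) => [/ih[K K0 hK]|_]; [by exists K|by exists 0].
pose K i := s2val (cid2 (ih' i)).
have K0 i : 0 <= K i := s2valP (cid2 (ih' i)).
have hK i : (i < n)%N -> forall d, (0 < d)%N -> `|coef (odeC a d) i| <= K i / d%:R
  := s2valP' (cid2 (ih' i)).
exists (n%:R * 2 + \sum_(i < n) K i * 2).
  by rewrite addr_ge0 ?mulr_ge0 ?sumr_ge0 // => i _; rewrite mulr_ge0.
move=> d d0; have d0' : 0 < d%:R :> R by rewrite ltr0n.
(* Newton's identity: coefficient n of C D = - z D', where D has constant coefficient 1. *)
have -> : coef (odeC a d) n = - (n%:R * coef (odeD a d) n) -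
    \sum_(i < n) coef (odeC a d) i * coef (odeD a d) (n - i)%N.
  rewrite -[- (_ * _)]/(coef (- fps_euler (odeD a d)) n) -odeC_M fcoefM.
  rewrite big_ord_recr [nat_of_ord ord_max]/= subnn coef_odeD0 mulr1.
  by rewrite addrC addKr.
apply: le_trans (ler_normB _ _) _; rewrite mulrDl normrN normrM normr_nat.
apply: lerD.
  case: (n) => [|m]; first by rewrite !mul0r.
  by rewrite -mulrA ler_wpM2l // coef_odeD_bound.
rewrite mulr_suml; apply: le_trans (ler_norm_sum _ _ _) _.
apply: ler_sum => i _; rewrite normrM.
have := ltn_ord i; rewrite -subn_gt0; case E : (n - i)%N => [//|m] _.
have D2 : `|coef (odeD a d) m.+1| <= 2.
  apply: le_trans (coef_odeD_bound _ a0 d0) _.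
  by rewrite ler_pdivrMr // ler_peMr // -[1]/(1%:R) ler_nat.
apply: le_trans (ler_pM _ _ (hK i (ltn_ord i) d d0) D2) _ => //.
by rewrite mulrAC.
Qed.

Lemma powersum_partial a d k M : (0 < a)%N -> (0 < d)%N -> (0 < k)%N ->
  \sum_(0 <= m < M) (-1) ^+ (m * k) / (d + m * a)%:R ^+ k =
  coef (odeC a d) k - (-1) ^+ (M * k) * coef (odeC a (d + M * a)) k.
Proof.
move=> a0 d0 k0; elim: M => [|M ih].
  by rewrite big_nil mul0n expr0 mul1r addn0 subrr.
rewrite big_nat_recr // -[LHS]/(_ + _) ih (@odeC_rec a (d + M * a)) ?addn_gt0 ?d0 //.
rewrite -addnA -mulSnr (mulSnr M k) exprD; ring.
Qed.

(** The remainder after M terms is, up to sign, C_k(d + Ma) = O(1/M). This covers k = 1, where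
    convergence is only conditional. *)
Lemma powersum_cvg a d k : (0 < a)%N -> (0 < d)%N -> (0 < k)%N ->
  series (fun m : nat => (-1) ^+ (m * k) / (d + m * a)%:R ^+ k : R) @ \oo -->
  coef (odeC a d) k.
Proof.
move=> a0 d0 k0; have [K K0 hK] := coef_odeC_bound k a0.
rewrite -[X in _ --> X]subr0.
have -> : series (fun m : nat => (-1) ^+ (m * k) / (d + m * a)%:R ^+ k : R) =
   (fun M : nat => coef (odeC a d) k - (-1) ^+ (M * k) * coef (odeC a (d + M * a)) k).
  by apply/funext => M; rewrite -powersum_partial.
apply: cvgB; first exact: cvg_cst.
have lK : K * (M.+1%:R)^-1 @[M --> \oo] --> (0 : R).
  rewrite -[X in _ --> X](mulr0 K); apply: cvgM; first exact: cvg_cst.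
  exact: cvg_harmonic.
apply: (@squeeze_cvgr _ _ _ _ (fun M : nat => - (K * (M.+1%:R)^-1))
                              (fun M => K * (M.+1%:R)^-1)) => //.
  near=> M; rewrite -ler_norml normrM normrX normrN1 expr1n mul1r.
  apply: le_trans (hK _ _) _; first by rewrite addn_gt0 d0.
  rewrite ler_wpM2l // lef_pV2 ?posrE ?ltr0n ?addn_gt0 ?d0 //.
  rewrite ler_nat -add1n leq_add //.
  exact: leq_pmulr.
by rewrite -[X in _ --> X]oppr0; exact: cvgN.
Unshelve. all: by end_near. Qed.

End PowerSums.

(** * Truncated determinants *)

Section Resolvent.
Context {R : realType}.
Variables (a d : nat).
Hypothesis d0 : (0 < d)%N.
Hypothesis da : (d < a)%N.
Implicit Types (s u : R).

Let a0 : (0 < a)%N. Proof. exact: leq_ltn_trans da. Qed.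
Let e0 : (0 < a - d)%N. Proof. by rewrite subn_gt0. Qed.

Lemma kw_compl s : 0 < s -> kw a (a - d) s = kv a d s.
Proof.
move=> s0; rewrite /kw /kv; congr (_ / _).
have -> : s ^+ a = s ^+ (a - d).-1 * s ^+ d.+1.
  by rewrite -exprD addnS -addSn prednK // subnK // ltnW.
by rewrite mulfK // expf_neq0 // gt_eqF.
Qed.

Lemma kv_compl s : 0 < s -> kv a (a - d) s = kw a d s.
Proof.
move=> s0; rewrite /kw /kv; congr (_ / _).
have -> : s ^+ a = s ^+ d.-1 * s ^+ (a - d).+1.
  by rewrite -exprD addnS -addSn prednK // addnC subnK // ltnW.
by rewrite mulfK // expf_neq0 // gt_eqF.
Qed.

(** The substitution s = 1/u carries v_d(s) ds to w_d(u) du, up to orientation. *)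
Lemma kv_inv u : 0 < u -> kv a d u^-1 * u ^- 2 = kw a d u.
Proof.
move=> u0; rewrite /kw /kv !exprVn.
have un : u != 0 by rewrite gt_eqF.
have ua : u ^+ a != 0 by rewrite expf_neq0.
have ud : u ^+ d.-1 != 0 by rewrite expf_neq0.
have den : 1 + u ^+ a != 0 by rewrite gt_eqF // kernel_den_gt0.
have den' : u ^+ a + 1 != 0 by rewrite addrC.
have -> : u ^+ d.+1 = u ^+ d.-1 * u ^+ 2 by rewrite -exprD addn2 prednK.
by field; rewrite un ua ud den.
Qed.

Let X := odeX (R := R) a d.
Let Y := odeY (R := R) a d.
(** Replacing d by a - d exchanges the two kernels; with -z for z this yields the solution with
    value (0, 1) at 0. *)
Let X1 s := fps_flip (odeY (R := R) a (a - d) s).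
Let Y1 s := fps_flip (odeX (R := R) a (a - d) s).

Let dX s : 0 < s -> fps_derive X s (- (fpsZ R * (fpsC (kv a d s) * Y s))).
Proof. exact: odeX_derive. Qed.

Let dY s : 0 < s -> fps_derive Y s (fpsZ R * (fpsC (kw a d s) * X s)).
Proof. exact: odeY_derive. Qed.

Let dX1 s : 0 < s -> fps_derive X1 s (- (fpsZ R * (fpsC (kv a d s) * Y1 s))).
Proof.
move=> s0; apply: fps_derive_eq (fps_derive_flip (odeY_derive a0 e0 s0)) _.
by rewrite kw_compl // !(fps_flipM, fps_flipC, fps_flipZ) mulNr.
Qed.

Let dY1 s : 0 < s -> fps_derive Y1 s (fpsZ R * (fpsC (kw a d s) * X1 s)).
Proof.
move=> s0; apply: fps_derive_eq (fps_derive_flip (odeX_derive a0 e0 s0)) _.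
by rewrite kv_compl // !(fps_flipN, fps_flipM, fps_flipC, fps_flipZ) mulNr opprK.
Qed.

Let lX : fps_lim0 X 1. Proof. exact: odeX_lim0. Qed.
Let lY : fps_lim0 Y 0. Proof. exact: odeY_lim0. Qed.
Let flip0 : fps_flip 0 = 0 :> fps R.
Proof. by rewrite -fpsC0 fps_flipC. Qed.
Let lX1 : fps_lim0 X1 0.
Proof. by rewrite -flip0; apply: fps_lim0_flip; exact: odeY_lim0. Qed.
Let lY1 : fps_lim0 Y1 1.
Proof. by rewrite -(fps_flip1 R); apply: fps_lim0_flip; exact: odeX_lim0. Qed.

(** The matrix of the system has trace 0. *)
Lemma wronskian s : 0 < s -> X s * Y1 s - X1 s * Y s = 1.
Proof.
move: s; apply: (@fps_derive0_lim _ (fun s => X s * Y1 s - X1 s * Y s)).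
  move=> s s0; apply: fps_derive_eq.
    exact: fps_deriveB (fps_deriveM (dX s0) (dY1 s0)) (fps_deriveM (dX1 s0) (dY s0)).
  ring.
have := fps_lim0B (fps_lim0M lX lY1) (fps_lim0M lX1 lY).
by rewrite mulr1 mulr0 subr0.
Qed.

(** [al] and [be] are given by Cramer's rule for the value (1, 1) at 1, the Wronskian being 1. *)
Let al := Y1 1 - X1 1.
Let be := odeD (R := R) a d.
(* The solution with value (1, 1) at 1; its second component tends to odeD at 0. *)
Definition shootX s := al * X s + be * X1 s.
Definition shootY s := al * Y s + be * Y1 s.
Let x := shootX.
Let y := shootY.

Let dx s : 0 < s -> fps_derive x s (- (fpsZ R * (fpsC (kv a d s) * y s))).
Proof.
move=> s0; apply: fps_derive_eq.
  exact: fps_deriveD (fps_deriveM (fps_derive_cst al s) (dX s0))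
                     (fps_deriveM (fps_derive_cst be s) (dX1 s0)).
by rewrite /y /shootY; ring.
Qed.

Let dy s : 0 < s -> fps_derive y s (fpsZ R * (fpsC (kw a d s) * x s)).
Proof.
move=> s0; apply: fps_derive_eq.
  exact: fps_deriveD (fps_deriveM (fps_derive_cst al s) (dY s0))
                     (fps_deriveM (fps_derive_cst be s) (dY1 s0)).
by rewrite /x /shootX; ring.
Qed.

Let x1 : x 1 = 1.
Proof.
have W := @wronskian 1 ltr01.
rewrite /x /shootX /al /be /odeD -/(X 1) -/(Y 1) -[RHS]W; ring.
Qed.

Let y1 : y 1 = 1.
Proof.
have W := @wronskian 1 ltr01.
rewrite /y /shootY /al /be /odeD -/(X 1) -/(Y 1) -[RHS]W; ring.
Qed.

Let lx : fps_lim0 x al.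
Proof.
have := fps_lim0D (fps_lim0M (@fps_lim0_cst R al) lX)
                  (fps_lim0M (@fps_lim0_cst R be) lX1).
by rewrite mulr1 mulr0 addr0.
Qed.

Let ly : fps_lim0 y be.
Proof.
have := fps_lim0D (fps_lim0M (@fps_lim0_cst R al) lY)
                  (fps_lim0M (@fps_lim0_cst R be) lY1).
by rewrite mulr1 mulr0 add0r.
Qed.

(** The integral of w_d over ]0, s], since Y starts with z \int w_d; up to the sine constant it is
    [psi] for d = 1 and [phi] for d = a - 1. *)
Definition psi1 s := coef (odeY a d s) 1.

Lemma psi1_derive s : 0 < s -> is_derive s 1 psi1 (kw a d s).
Proof.
move=> s0; apply: is_derive_eq (dY s0 1%N) _.
by rewrite fcoefZM fcoefCM mulr1.
Qed.

Lemma psi1_lim0 : psi1 s @[s --> 0^'+] --> 0.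
Proof. by have := @lY 1%N; rewrite fcoef0. Qed.

(* At s = 1/u, fredD is det(1 - zT_u), and the coefficients of fredP and fredC
   are the path and cycle integrals over coordinates bounded by u. *)
Definition fredD s := y s - fpsZ R * (fpsC (psi1 s) * x s).
Definition fredP s := x s * fps_inv (fredD s).
Definition fredE s := y s * fps_inv (fredD s).
Definition fredC s := - fps_euler (fredD s) * fps_inv (fredD s).

Lemma coef_fredD0 s : coef (fredD s) 0 = 1.
Proof.
rewrite /fredD fcoefD fcoefN fcoefZM subr0 /y /shootY fcoefD !fcoefM0 coef_odeD0.
by rewrite mulr0 add0r mul1r /= expr0 mulr1.
Qed.

Let DV s : fredD s * fps_inv (fredD s) = 1.
Proof. by rewrite fps_mulV // coef_fredD0. Qed.

(** The denominator y - z psi1 x is the one for which P = x/D and E = y/D satisfy this relation; it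
    linearizes the Riccati system. *)
Lemma fredE_P s : fredE s = 1 + fpsZ R * (fpsC (psi1 s) * fredP s).
Proof. by rewrite -[1](DV s) /fredE /fredP {2}/fredD; ring. Qed.

Let Nm s := fpsZ R * (fpsZ R * (fpsC (psi1 s * kv a d s) * fredE s)).

Let dD s : 0 < s -> fps_derive fredD s (Nm s * fredD s).
Proof.
move=> s0; apply: fps_derive_eq.
  exact: fps_deriveB (dy s0) (fps_deriveM (fps_derive_cst (fpsZ R) s)
    (fps_deriveM (fps_deriveC (psi1_derive s0)) (dx s0))).
rewrite /Nm /fredE fpsCM.
transitivity (fpsZ R * (fpsZ R * (fpsC (psi1 s) * fpsC (kv a d s) * y s)) *
  (fredD s * fps_inv (fredD s))); last by ring.
rewrite DV; ring.
Qed.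

(** [fps_derivable_inv] provides some derivative; the product rule on D * D^-1 = 1 identifies it. *)
Let dDV s : 0 < s ->
  fps_derive (fun t => fps_inv (fredD t)) s (- Nm s * fps_inv (fredD s)).
Proof.
move=> s0; have [L dL] := fps_derivable_inv (dD s0).
apply: (fps_derive_eq dL).
have := fps_deriveM (dD s0) dL.
have -> : (fun t => fredD t * fps_inv (fredD t)) = (fun=> 1).
  by apply/funext => t; exact: DV.
move=> /fps_derive_unique /(_ (fps_derive_cst 1 s)) h.
apply: (@fps_mulI _ (fredD s)); first exact: coef_fredD0.
transitivity (Nm s * fredD s * fps_inv (fredD s) + fredD s * L -
              Nm s * (fredD s * fps_inv (fredD s))); first by ring.
by rewrite h; ring.
Qed.

(** The Riccati equation: the largest vertex of a path leaves an arm on either side, whence the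
    square. *)
Lemma fredP_derive s : 0 < s ->
  fps_derive fredP s (- (fpsZ R * (fpsC (kv a d s) * (fredE s * fredE s)))).
Proof.
move=> s0; apply: fps_derive_eq (fps_deriveM (dx s0) (dDV s0)) _.
have -> : fredE s * fredE s =
    (1 + fpsZ R * (fpsC (psi1 s) * fredP s)) * fredE s by rewrite fredE_P.
rewrite /Nm fpsCM /fredE /fredP; ring.
Qed.

Lemma fredC_derive s : 0 < s -> fps_derive fredC s (- fps_euler (Nm s)).
Proof.
move=> s0; have dE := fps_deriveN (fps_derive_euler (dD s0)).
apply: fps_derive_eq (fps_deriveM dE (dDV s0)) _.
rewrite fps_eulerM.
transitivity (- fps_euler (Nm s) * (fredD s * fps_inv (fredD s))); first by ring.
by rewrite DV mulr1.
Qed.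

Let lD : fps_lim0 fredD be.
Proof.
have := fps_lim0B ly (fps_lim0M (@fps_lim0_cst R (fpsZ R))
   (fps_lim0M (fps_lim0C psi1_lim0) lx)).
by rewrite fpsC0 mul0r mulr0 subr0.
Qed.

Lemma fredC_lim0 : fps_lim0 fredC (odeC a d).
Proof.
exact: fps_lim0M (fps_lim0N (fps_lim0_euler lD)) (fps_lim0_inv lD).
Qed.

Let D1 : fredD 1 = 1 - fpsZ R * fpsC (psi1 1).
Proof. by rewrite /fredD y1 x1 mulr1. Qed.

Lemma fredP_1 n : coef (fredP 1) n = psi1 1 ^+ n.
Proof.
suff -> : fredP 1 = Fps (fun n => psi1 1 ^+ n) by [].
apply: (@fps_mulI _ (fredD 1)); first exact: coef_fredD0.
rewrite /fredP x1 mul1r DV D1.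
rewrite mulrBl mul1r -mulrA; apply/fpsP => -[|m];
  rewrite fcoefD fcoefN fcoefZM ?fcoefCM /= ?subr0 //.
by rewrite exprS subrr.
Qed.

Lemma fredC_1 n : (0 < n)%N -> coef (fredC 1) n = psi1 1 ^+ n.
Proof.
case: n => // n _.
suff -> : fredC 1 = fpsZ R * (fpsC (psi1 1) * fredP 1).
  by rewrite fcoefZM fcoefCM fredP_1 exprS.
rewrite /fredC /fredP x1 D1 fps_eulerD fps_eulerN fps_euler1 fps_eulerM.
by rewrite fps_eulerZ fps_eulerC; ring.
Qed.

Let invf_derive u : 0 < u -> is_derive u 1 (fun t : R => t^-1) (- u ^- 2).
Proof.
move=> u0; apply: is_derive_eq.
  by apply: (@is_deriveV _ id); rewrite gt_eqF.
by rewrite /GRing.scale /= mulr1.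
Qed.

(** The integral over an arm of i vertices attached to a largest vertex with coordinate u: its first
    vertex is confined below 1/u, hence does not constrain the next one, which is at most u, and j
    free path vertices remain. *)
Definition pathE i u := if i is j.+1 then psi1 u^-1 * coef (fredP u^-1) j else 1.

Let coef_fredE i u : coef (fredE u^-1) i = pathE i u.
Proof.
rewrite fredE_P fcoefD fcoefZM fcoef1; case: i => [|i]; first by rewrite addr0.
by rewrite fcoefCM add0r.
Qed.

Lemma path_derive n u : 0 < u ->
  is_derive u 1 (fun t => coef (fredP t^-1) n)
    (kw a d u * if n is m.+1 then \sum_(i < m.+1) pathE i u * pathE (m - i) u else 0).
Proof.
move=> u0; have uV : 0 < u^-1 by rewrite invr_gt0.
have := @is_derive1_comp R (fun t => coef (fredP t) n) _ _ _ _
  (fredP_derive uV n) (invf_derive u0).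
move=> /is_derive_eq; apply.
rewrite fcoefN fcoefZM; case: n => [|n]; first by rewrite oppr0 mul0r mulr0.
rewrite fcoefCM fcoefM -(kv_inv u0).
under eq_bigr do rewrite !coef_fredE.
ring.
Qed.

(** Any of the k vertices can be the largest. One of its neighbours gives the factor [psi1], the
    other begins an arm of k - 2 vertices, empty for k = 2, where the neighbours coincide. In the
    proof the factor k comes from z d/dz. *)
Lemma cycle_derive k u : 0 < u ->
  is_derive u 1 (fun t => coef (fredC t^-1) k)
    (if k is m.+2 then k%:R * (kw a d u * psi1 u^-1 * pathE m u) else 0).
Proof.
move=> u0; have uV : 0 < u^-1 by rewrite invr_gt0.
have := @is_derive1_comp R (fun t => coef (fredC t) k) _ _ _ _
  (fredC_derive uV k) (invf_derive u0).
move=> /is_derive_eq; apply.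
rewrite fcoefN -[coef (fps_euler _) k]/(k%:R * coef (Nm u^-1) k) /Nm fcoefZM; case: k => [|k].
  by rewrite mulr0 oppr0 mul0r.
rewrite fcoefZM; case: k => [|k]; first by rewrite mulr0 oppr0 mul0r.
rewrite fcoefCM coef_fredE -(kv_inv u0); ring.
Qed.

Lemma cycle_cvgy k :
  coef (fredC u^-1) k @[u --> +oo] --> coef (odeC (R := R) a d) k.
Proof.
apply: (@cvg_comp _ _ _ (fun u : R => u^-1) (fun s => coef (fredC s) k) _ (0^'+)).
  move=> B [e /= e_gt0 hB]; near=> u.
  have u0 : 0 < u by near: u; exact: nbhs_pinfty_gt.
  apply: hB; last by rewrite invr_gt0.
  rewrite /= sub0r normrN gtr0_norm ?invr_gt0 // invf_plt ?posrE //.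
  by near: u; apply: nbhs_pinfty_gt; exact: num_real.
exact: fredC_lim0.
Unshelve. all: by end_near. Qed.

End Resolvent.

(** * Recursion on the largest coordinate *)

Section MaxRecursion.
Context {R : realType} {T : finType}.
Variables (e : rel T) (w ps : R -> R).
Implicit Types (V : {set T}) (f : R -> R) (r : T) (s u : R).

Definition nbh r : {set T} := [set z | e r z].
Definition prune V r := V :\: (r |: nbh r).

(* Characterizes f(u) as the integral of the product of the w(x_v), v in V, over
   0 <= x_v <= u and x_v x_v' < 1 on the edges of e, for u >= 1, with
   ps(u) = \int_0^(1/u) w: a largest coordinate x_r = u > 1 forces the
   neighbours of r below 1/u. *)
Inductive max_rec V f : Prop :=
  MaxRec (g : T -> R -> R) of
    (forall r, r \in V -> max_rec (prune V r) (g r)) &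
    f 1 = ps 1 ^+ #|V| &
    (forall u, 0 < u -> is_derive u 1 f
      (\sum_(r in V) w u * ps u ^+ #|nbh r :&: V| * g r u)).

Lemma prune_setU V1 V2 r :
  prune (V1 :|: V2) r = prune V1 r :|: prune V2 r.
Proof. by rewrite /prune finset.setDUl. Qed.

(** The largest coordinate lies in one part and leaves the other untouched, so the recursion for the
    union is the product rule. *)
Lemma max_recM V1 V2 f1 f2 : symmetric e ->
  (forall x y, x \in V1 -> y \in V2 -> (x != y) && ~~ e x y) ->
  max_rec V1 f1 -> max_rec V2 f2 ->
  max_rec (V1 :|: V2) (fun u => f1 u * f2 u).
Proof.
move=> esym sep h1 h2; elim: h1 V2 f2 h2 sep.
move=> {}V1 {}f1 g1 hg1 ih1 f11 df1 V2 f2 h2; move: (h2); elim: h2.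
move=> {}V2 {}f2 g2 hg2 ih2 f21 df2 h2 sep.
have disj : disjoint (mem V1) (mem V2).
  apply/pred0Pn => -[x /andP[/= x1 x2]].
  by have := sep _ _ x1 x2; rewrite eqxx.
have keep1 r : r \in V1 -> prune V2 r = V2.
  move=> r1; apply/setP => z; rewrite !finset.inE negb_or.
  case: (boolP (z \in V2)) => z2; rewrite ?andbF // andbT.
  by have := sep _ _ r1 z2; rewrite eq_sym.
have keep2 r : r \in V2 -> prune V1 r = V1.
  move=> r2; apply/setP => z; rewrite !finset.inE negb_or.
  case: (boolP (z \in V1)) => z1; rewrite ?andbF // andbT.
  by have := sep _ _ z1 r2; rewrite esym.
have deg1 r : r \in V1 -> nbh r :&: (V1 :|: V2) = nbh r :&: V1.
  move=> r1; apply/setP => z; rewrite !finset.inE.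
  case: (boolP (z \in V2)) => z2; last by rewrite orbF.
  by have /andP[_ /negbTE ->] := sep _ _ r1 z2.
have deg2 r : r \in V2 -> nbh r :&: (V1 :|: V2) = nbh r :&: V2.
  move=> r2; apply/setP => z; rewrite !finset.inE.
  case: (boolP (z \in V1)) => z1 //.
  by have /andP[_ /negbTE] := sep _ _ z1 r2; rewrite esym => ->.
exists (fun r => if r \in V1 then (fun u => g1 r u * f2 u)
                 else (fun u => f1 u * g2 r u)).
- move=> r; rewrite finset.inE prune_setU; case: ifPn => [r1 _|_ /= r2].
    rewrite keep1 //; apply: ih1 => // x y.
    by rewrite finset.inE => /andP[_ x1]; exact: sep.
  rewrite keep2 //; apply: ih2 => //; first exact: hg2.
  by move=> x y x1; rewrite finset.inE => /andP[_]; exact: sep.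
- by rewrite f11 f21 -exprD cardsU disjoint_setI0 // cards0 subn0.
- move=> u u0.
  apply: is_derive_eq; first exact: (is_deriveM (df1 u u0) (df2 u u0)).
  rewrite /GRing.scale /= [RHS](eq_bigl (fun r => (r \in V1) || (r \in V2))); last first.
    by move=> r; rewrite finset.inE.
  rewrite bigU //= [LHS]addrC !mulr_sumr; congr (_ + _); apply: eq_bigr => r rV.
    by rewrite rV deg1 //; ring.
  have /negbTE -> : r \notin V1 by apply: contraL rV => /(disjointFr disj) ->.
  by rewrite deg2 //; ring.
Qed.

End MaxRecursion.

(** * Paths satisfy the recursion on the largest coordinate *)

Section PathRecursion.
Context {R : realType} {T : finType}.
Variables (e : rel T) (w ps : R -> R) (Pf : nat -> R -> R).
Hypothesis e_sym : symmetric e.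

(** The arm integral [pathE], for abstract path functions. *)
Definition path_factor i (u : R) := if i is j.+1 then ps u * Pf j u else 1.

Hypothesis Pf1 : forall n, Pf n 1 = ps 1 ^+ n.
Hypothesis dPf : forall n (u : R), 0 < u -> is_derive u (1 : R) (Pf n)
  (w u * if n is m.+1 then \sum_(i < m.+1) path_factor i u * path_factor (m - i) u
         else 0).

Lemma path_fun0 u : 0 < u -> Pf 0 u = 1.
Proof.
move=> u0; rewrite -[1](expr0 (ps 1)) -Pf1.
apply: (@derive0_pos_cst R (Pf 0)) => // s s0.
by apply: is_derive_eq (dPf 0 s0) _; rewrite mulr0.
Qed.

Lemma path_factorE i u : 0 < u ->
  path_factor i u = ps u ^+ (0 < i)%N * Pf i.-1 u.
Proof. by move=> u0; case: i => [|i] /=; rewrite ?expr1 // path_fun0 // mulr1. Qed.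

Variables (p : nat -> T) (N : nat).
Hypothesis p_inj : forall i j, (i < N)%N -> (j < N)%N -> p i = p j -> i = j.
Hypothesis p_edge : forall i j, (i < N)%N -> (j < N)%N ->
  e (p i) (p j) = (i == j.+1) || (j == i.+1).

Definition path_seg lo n : {set T} := [set x in [seq p i | i <- iota lo n]].

Lemma path_segP lo n x :
  reflect (exists2 i, (lo <= i < lo + n)%N & x = p i) (x \in path_seg lo n).
Proof.
rewrite finset.inE; apply: (iffP mapP) => -[i]; first by rewrite mem_iota; exists i.
by move=> ? ?; exists i => //; rewrite mem_iota.
Qed.

(** An empty segment may start anywhere: pruning at the last vertex produces one whose start can
    exceed N. *)
Lemma mem_path_seg lo n i : ((n == 0) || (lo + n <= N))%N -> (i < N)%N ->
  (p i \in path_seg lo n) = (lo <= i < lo + n)%N.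
Proof.
move=> lnN iN; apply/path_segP/idP => [[j jn /p_inj -> //]|]; last by exists i.
by lia.
Qed.

Lemma path_seg_uniq lo n : ((n == 0) || (lo + n <= N))%N -> uniq [seq p i | i <- iota lo n].
Proof.
move=> lnN; rewrite map_inj_in_uniq ?iota_uniq // => i j.
by rewrite !mem_iota => ii jj; apply: p_inj; lia.
Qed.

Lemma card_path_seg lo n : ((n == 0) || (lo + n <= N))%N -> #|path_seg lo n| = n.
Proof.
move=> lnN; rewrite cardsE.
by rewrite (card_uniqP _) ?path_seg_uniq // size_map size_iota.
Qed.

(** The arms of lengths i and n - 1 - i each lose the vertex next to the removed one; the truncated
    predecessor leaves an empty arm empty. *)
Lemma prune_path_seg lo n i : ((n == 0) || (lo + n <= N))%N -> (i < n)%N ->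
  prune e (path_seg lo n) (p (lo + i)) =
  path_seg lo i.-1 :|: path_seg (lo + i + 2) (n - 1 - i).-1.
Proof.
move=> lnN lin; have liN : (lo + i < N)%N by lia.
apply/setP => x; rewrite finset.in_setD !finset.in_setU.
case: (boolP (x \in path_seg lo n)) => [/path_segP[j jn ->]|xn].
  have jN : (j < N)%N by lia.
  rewrite andbT !mem_path_seg ?finset.in_set1 ?finset.inE ?p_edge //; try lia.
  rewrite (_ : (p j == p (lo + i)) = (j == lo + i)%N); first by lia.
  by apply/eqP/eqP => [/p_inj|->//]; apply.
rewrite andbF; apply/esym/negbTE; rewrite negb_or; apply/andP; split;
  apply: contra xn => /path_segP[j jn ->]; rewrite mem_path_seg //; lia.
Qed.

Lemma deg_path_seg lo n i : ((n == 0) || (lo + n <= N))%N -> (i < n)%N ->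
  #|nbh e (p (lo + i)) :&: path_seg lo n| = ((0 < i) + (0 < n - 1 - i))%N.
Proof.
move=> lnN lin; have liN : (lo + i < N)%N by lia.
have -> : nbh e (p (lo + i)) :&: path_seg lo n =
    path_seg (lo + i).-1 (0 < i) :|: path_seg (lo + i).+1 (0 < n - 1 - i).
  apply/setP => x; rewrite finset.in_setI finset.in_setU.
  case: (boolP (x \in path_seg lo n)) => [/path_segP[j jn ->]|xn].
    have jN : (j < N)%N by lia.
    by rewrite andbT !mem_path_seg ?finset.inE ?p_edge //; try lia.
  rewrite andbF; apply/esym/negbTE; rewrite negb_or; apply/andP; split;
    apply: contra xn => /path_segP[j jn ->]; rewrite mem_path_seg //; lia.
rewrite cardsU !card_path_seg; try lia.
rewrite (_ : _ :&: _ = finset.set0) ?cards0 ?subn0 //.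
apply/setP => x; rewrite finset.in_setI finset.in_set0; apply/negbTE/negP => /andP[].
move=> /path_segP[j jn ->] /path_segP[j' jn' /p_inj]; lia.
Qed.

Lemma max_rec_path n lo : ((n == 0) || (lo + n <= N))%N ->
  max_rec e w ps (path_seg lo n) (Pf n).
Proof.
elim/ltn_ind: n lo => n ih lo lnN.
(* [max_rec] indexes the remaining functions by vertices, so positions must be recovered from
   them. *)
pose idx r := index r [seq p i | i <- iota lo n].
have idxE i : (i < n)%N -> idx (p (lo + i)) = i.
  move=> lin.
  have <- : nth (p lo) [seq p i | i <- iota lo n] i = p (lo + i)%N.
    by rewrite (nth_map 0%N) ?size_iota // nth_iota.
  by rewrite /idx index_uniq ?path_seg_uniq // size_map size_iota.
exists (fun r u => Pf (idx r).-1 u * Pf (n - 1 - idx r).-1 u).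
- move=> r /path_segP[j jn ->]; have -> : j = (lo + (j - lo))%N by lia.
  have lin : (j - lo < n)%N by lia.
  rewrite idxE // prune_path_seg //; apply: max_recM => //.
  + move=> x y /path_segP[j1 j1n ->] /path_segP[j2 j2n ->].
    rewrite p_edge; try lia.
    apply/andP; split; last by lia.
    by apply/eqP => /p_inj; lia.
  + by apply: ih; lia.
  + by apply: ih; lia.
- by rewrite card_path_seg // Pf1.
- move=> u u0; apply: is_derive_eq (dPf n u0) _.
  have -> : \sum_(r in path_seg lo n) w u * ps u ^+ #|nbh e r :&: path_seg lo n| *
      (Pf (idx r).-1 u * Pf (n - 1 - idx r).-1 u) =
      \sum_(i < n) w u * (path_factor i u * path_factor (n - 1 - i) u).
    rewrite (eq_bigl (fun r => r \in [seq p i | i <- iota lo n])); last first.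
      by move=> r; rewrite finset.inE.
    rewrite -big_uniq ?path_seg_uniq // big_map -[lo in iota lo n]addn0 iotaDl big_map.
    rewrite -[in iota _ n](subn0 n) -/(index_iota 0 n) big_mkord.
    apply: eq_bigr => i _; rewrite idxE // deg_path_seg // exprD.
    by rewrite !path_factorE //; ring.
  case: (n) => [|m]; first by rewrite big_ord0 mulr0.
  by rewrite mulr_sumr; apply: eq_bigr => i _; rewrite subn1.
Qed.

End PathRecursion.

(** * The cycle satisfies the recursion on the largest coordinate *)

Section Cycle.
Context {R : realType}.
Variable k : nat.
Hypothesis k2 : (1 < k)%N.
Implicit Types (r x y : 'I_k) (u : R).

Let k0 : (0 < k)%N. Proof. exact: ltnW. Qed.

Definition cyc_rel x y := y \in cyc_nbrs x.

Lemma nbh_cyc x : nbh cyc_rel x = cyc_nbrs x.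
Proof. by apply/setP => y; rewrite finset.inE. Qed.

Lemma cyc_relE x y : cyc_rel x y = (ordS y == x) || (y == ordS x).
Proof.
rewrite /cyc_rel /cyc_nbrs !finset.inE; congr (_ || _).
by apply/eqP/eqP => [->|<-]; rewrite ?ord_predK ?ordSK.
Qed.

Lemma cyc_rel_sym : symmetric cyc_rel.
Proof. by move=> x y; rewrite !cyc_relE orbC [ordS y == x]eq_sym [y == _]eq_sym. Qed.

Definition rot_ord r t : 'I_k := Ordinal (ltn_pmod (r + t) k0).

Lemma rot_ord_inj r t t' : (t < k)%N -> (t' < k)%N ->
  rot_ord r t = rot_ord r t' -> t = t'.
Proof.
move=> tk tk' /(congr1 val) /= /eqP.
by rewrite eqn_modDl !modn_small // => /eqP.
Qed.

Lemma rot_ord_surj r x : exists2 t, (t < k)%N & x = rot_ord r t.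
Proof.
exists ((x + (k - r)) %% k)%N; first exact: ltn_pmod.
apply/val_inj => /=; rewrite modnDmr addnCA subnKC; last exact: ltnW.
by rewrite modnDr modn_small.
Qed.

Lemma rot_ord0 r : rot_ord r 0 = r.
Proof. by apply/val_inj; rewrite /= addn0 modn_small. Qed.

Lemma ordS_rot r t : ordS (rot_ord r t) = rot_ord r t.+1.
Proof. by apply/val_inj; rewrite /= -addn1 modnDml addn1 addnS. Qed.

Lemma ordS_rot0 r : ordS r = rot_ord r 1.
Proof. by rewrite -{1}(rot_ord0 r) ordS_rot. Qed.

Lemma ord_pred_rot r : ord_pred r = rot_ord r k.-1.
Proof.
apply/(can_inj (@ordSK k)); rewrite ord_predK ordS_rot prednK //.
by apply/val_inj; rewrite /= modnDr modn_small.
Qed.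

(** For k = 2 the predecessor and the successor coincide. *)
Lemma card_cyc_nbrs r : #|cyc_nbrs r| = (k != 2).+1.
Proof.
rewrite /cyc_nbrs cards2 ord_pred_rot ordS_rot0.
suff -> : (rot_ord r k.-1 == rot_ord r 1) = (k == 2) by [].
apply/eqP/eqP => [/rot_ord_inj h|h]; first by have := h _ _; lia.
by congr rot_ord; rewrite h.
Qed.

Lemma cyc_path_edge r i j : (i < k - 3)%N -> (j < k - 3)%N ->
  cyc_rel (rot_ord r (2 + i)) (rot_ord r (2 + j)) = (i == j.+1) || (j == i.+1).
Proof.
move=> ik jk; rewrite cyc_relE !ordS_rot.
apply/orP/orP => -[/eqP h|/eqP h]; [left|right|left|right]; apply/eqP.
- by move: h => /rot_ord_inj; lia.
- by move: h => /rot_ord_inj; lia.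
- by rewrite h.
- by rewrite h.
Qed.

(** Offsets 0, 1 and k - 1 from r disappear and offsets 2 to k - 2 form a path. For k = 2 nothing is
    left, as the truncated k - 3 says. *)
Lemma prune_cycle r :
  prune cyc_rel [set: 'I_k]%SET r = path_seg (fun j => rot_ord r (2 + j)) 0 (k - 3).
Proof.
apply/setP => x; rewrite finset.in_setD finset.in_setT andbT nbh_cyc !finset.inE.
rewrite ord_pred_rot ordS_rot0 -{1}(rot_ord0 r).
have [t tk ->] := rot_ord_surj r x.
have rE t' : (t' < k)%N -> (rot_ord r t == rot_ord r t') = (t == t').
  by move=> t'k; apply/eqP/eqP => [/rot_ord_inj|->//]; apply.
rewrite !rE ?prednK //; try lia.
apply/idP/mapP => [h|[j]].
  exists (t - 2)%N; first by rewrite mem_iota; lia.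
  by congr rot_ord; lia.
by rewrite mem_iota => jk /rot_ord_inj; lia.
Qed.

Variables (w ps : R -> R) (Pf : nat -> R -> R) (Cf : R -> R).
Hypothesis Pf1 : forall n, Pf n 1 = ps 1 ^+ n.
Hypothesis dPf : forall n (u : R), 0 < u -> is_derive u (1 : R) (Pf n)
  (w u * if n is m.+1 then
           \sum_(i < m.+1) path_factor ps Pf i u * path_factor ps Pf (m - i) u
         else 0).
Hypothesis Cf1 : Cf 1 = ps 1 ^+ k.
Hypothesis dCf : forall u : R, 0 < u -> is_derive u (1 : R) Cf
  (k%:R * (w u * ps u * path_factor ps Pf (k - 2) u)).

Lemma max_rec_cycle : max_rec cyc_rel w ps [set: 'I_k]%SET Cf.
Proof.
exists (fun _ => Pf (k - 3)).
- move=> r _; rewrite prune_cycle.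
  apply: (@max_rec_path _ _ _ _ _ _ cyc_rel_sym Pf1 dPf _ (k - 3)).
  + by move=> i j ik jk /rot_ord_inj; lia.
  + by move=> i j ik jk; exact: cyc_path_edge.
  + by rewrite leqnn orbT.
- by rewrite cardsT card_ord.
- move=> u u0; apply: is_derive_eq (dCf u0) _.
  under eq_bigr do rewrite finset.setIT nbh_cyc card_cyc_nbrs.
  rewrite sumr_const cardsT card_ord -[RHS]mulr_natl; congr (_ * _).
  rewrite (@path_factorE _ w) //; case: eqVneq => [->|kn2] /=.
    by rewrite expr0 mul1r expr1.
  have -> : (0 < k - 2)%N by lia.
  by rewrite -subn1 -subnDA expr1 expr2; ring.
Qed.

End Cycle.

(** * Sums over admissible tuples *)

Section TupleSum.
Context {R : realType}.

Lemma is_derive_big (I : Type) (s : seq I) (P : pred I) (F : I -> R -> R)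
    (dF : I -> R) (u : R) :
  (forall i, P i -> is_derive u (1 : R) (F i) (dF i)) ->
  is_derive u (1 : R) (fun t => \sum_(i <- s | P i) F i t) (\sum_(i <- s | P i) dF i).
Proof.
move=> dFi; elim: s => [|i s ih].
  under eq_fun do rewrite big_nil.
  by rewrite big_nil; exact: is_derive_cst.
under eq_fun do rewrite big_cons.
rewrite big_cons; case: ifP => [Pi|//].
by apply: is_deriveD => //; exact: dFi.
Qed.

Lemma big_tuple_cons (T : finType) (A : nmodType) n (P : pred (seq T)) (F : seq T -> A) :
  \sum_(s : n.+1.-tuple T | P s) F s =
  \sum_(r : T) \sum_(s : n.-tuple T | P (r :: s)) F (r :: s).
Proof.
rewrite pair_big_dep /=.
rewrite (reindex (fun q : T * n.-tuple T => [tuple of q.1 :: q.2])) //=.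
exists (fun s : n.+1.-tuple T => (thead s, [tuple of behead s])).
  by case=> r s _ /=; rewrite theadE; congr pair; exact/val_inj.
by move=> s _; rewrite [RHS]tuple_eta; exact/val_inj.
Qed.

(** Outermost variable first, as in [simplex_int], for an integrand that is a product of
    one-variable functions. *)
Fixpoint iter_prim (hs : seq (R -> R)) (u : R) : R :=
  if hs is h :: hs' then prim1 (fun x => h x * iter_prim hs' x) u else 1.

Definition pos_cont (h : R -> R) := forall s : R, 0 < s -> {for s, continuous h}.

Fixpoint all_pos_cont (hs : seq (R -> R)) : Prop :=
  if hs is h :: hs' then pos_cont h /\ all_pos_cont hs' else True.

Lemma iter_prim_derive h hs (u : R) : all_pos_cont (h :: hs) -> 0 < u ->
  is_derive u (1 : R) (iter_prim (h :: hs)) (h u * iter_prim hs u).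
Proof.
elim: hs h u => [|h' hs ih] h u [ch chs] u0.
  apply: (@prim1_derive R (fun x => h x * 1)) => // s s0.
  by apply: cvgM; [exact: ch|exact: cvg_cst].
apply: (@prim1_derive R (fun x => h x * iter_prim (h' :: hs) x)) => // s s0.
apply: cvgM; first exact: ch.
exact: (is_derive_continuous (ih _ _ chs s0)).
Qed.

Lemma iter_prim_continuous hs : all_pos_cont hs -> pos_cont (iter_prim hs).
Proof.
case: hs => [_ s _|h hs chs s s0]; first exact: cvg_cst.
exact: (is_derive_continuous (iter_prim_derive chs s0)).
Qed.

Lemma iter_prim_1 h hs : iter_prim (h :: hs) 1 = 0.
Proof. exact: prim1_1. Qed.

Variables (T : finType) (e : rel T) (w ps : R -> R).
Hypothesis e_irr : irreflexive e.
Hypothesis cw : pos_cont w.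
Hypothesis cps : pos_cont ps.
Implicit Types (V : {set T}) (r : T) (s : seq T).

(** Entries come in decreasing order of coordinates, each surviving the pruning by the earlier ones;
    on the full cycle this is admissibility. *)
Fixpoint indep_in V s :=
  if s is r :: s' then (r \in V) && indep_in (prune e V r) s' else true.

(** Neighbours newly confined by each entry; on the cycle these are the alpha_j. *)
Fixpoint degs V s : seq nat :=
  if s is r :: s' then #|nbh e r :&: V| :: degs (prune e V r) s' else [::].

Definition weights V s := [seq (fun x => w x * ps x ^+ n) | n <- degs V s].

(** Vertices neither listed nor next to a listed one: their coordinates range over [0, 1] and
    contribute the power of [ps 1]. *)
Definition free V s := (#|V| - size s - sumn (degs V s))%N.

Lemma weights_cont V s : all_pos_cont (weights V s).
Proof.
rewrite /weights; elim: (degs V s) => //= n ns ih; split=> // x x0.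
apply: cvgM; first exact: cw.
apply: (@cvg_comp _ _ _ ps (fun y => y ^+ n) _ (nbhs (ps x))); first exact: cps.
exact: exprn_continuous.
Qed.

Lemma card_prune V r : r \in V -> #|prune e V r| = (#|V| - (1 + #|nbh e r :&: V|))%N.
Proof.
move=> rV; rewrite /prune cardsD; congr (_ - _)%N.
have -> : V :&: (r |: nbh e r) = r |: (nbh e r :&: V).
  apply/setP => z; rewrite !finset.inE.
  by case: eqVneq => [->|_] /=; rewrite ?rV // andbC.
by rewrite cardsU1 !finset.inE e_irr.
Qed.

Lemma free_cons V r s : r \in V -> free V (r :: s) = free (prune e V r) s.
Proof. by move=> rV; rewrite /free card_prune //=; lia. Qed.

Definition tuple_sum q V N (u : R) :=
  \sum_(0 <= n < N) \sum_(s : n.-tuple T | indep_in V s)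
    q ^+ free V s * iter_prim (weights V s) u.

Lemma sum_tuple0 (P : pred (seq T)) (F : seq T -> R) :
  P [::] -> \sum_(s : 0.-tuple T | P s) F s = F [::].
Proof.
move=> P0; rewrite (big_pred1 [tuple]) // => s.
by rewrite tuple0 /= P0 eqxx.
Qed.

Lemma tuple_sumS q V N u : tuple_sum q V N.+1 u =
  q ^+ #|V| + \sum_(0 <= n < N) \sum_(r in V) \sum_(s : n.-tuple T | indep_in (prune e V r) s)
     q ^+ free (prune e V r) s * iter_prim (weights V (r :: s)) u.
Proof.
rewrite /tuple_sum big_nat_recl //; congr (_ + _).
  rewrite (@sum_tuple0 (indep_in V) (fun s => q ^+ free V s * iter_prim (weights V s) u)) //.
  by rewrite /free /= !subn0 mulr1.
apply: eq_bigr => n _.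
rewrite (@big_tuple_cons _ _ n (indep_in V) (fun s => q ^+ free V s * iter_prim (weights V s) u)).
rewrite [RHS]big_mkcond /=; apply: eq_bigr => r _; case: ifPn => rV.
  by apply: eq_bigr => s _; rewrite free_cons.
by rewrite big_pred0.
Qed.

(** Differentiating in the outer bound fixes the largest coordinate at u, which is the recursion of
    [max_rec]. *)
Lemma tuple_sum_derive q V N (u : R) : 0 < u ->
  is_derive u (1 : R) (tuple_sum q V N.+1)
    (\sum_(r in V) w u * ps u ^+ #|nbh e r :&: V| * tuple_sum q (prune e V r) N u).
Proof.
move=> u0; rewrite (funext (tuple_sumS q V N)).
have dS (n : nat) : is_derive u (1 : R)
    (fun t => \sum_(r in V) \sum_(s : n.-tuple T | indep_in (prune e V r) s)
       q ^+ free (prune e V r) s * iter_prim (weights V (r :: s)) t)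
    (\sum_(r in V) \sum_(s : n.-tuple T | indep_in (prune e V r) s)
       q ^+ free (prune e V r) s *
       (w u * ps u ^+ #|nbh e r :&: V| * iter_prim (weights (prune e V r) s) u)).
  apply: is_derive_big => r _; apply: is_derive_big => s _.
  apply: is_deriveZ; apply: iter_prim_derive => //.
  exact: (weights_cont V (r :: s)).
have dG := is_derive_big (index_iota 0 N) (P := xpredT) (fun n _ => dS n).
apply: is_derive_eq (is_deriveD (is_derive_cst (q ^+ #|V|) u 1) dG) _.
rewrite add0r exchange_big /=; apply: eq_bigr => r _.
rewrite /tuple_sum mulr_sumr; apply: eq_bigr => n _.
rewrite mulr_sumr; apply: eq_bigr => s _.
ring.
Qed.

Lemma tuple_sum_1 q V N : tuple_sum q V N.+1 1 = q ^+ #|V|.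
Proof.
rewrite tuple_sumS big1 ?addr0 // => n _; rewrite big1 // => r _.
by rewrite big1 // => s _; rewrite iter_prim_1 mulr0.
Qed.

(** Both sides have the same derivative and the same value at 1. Every pruning removes at least one
    vertex, so a cutoff of at least #|V| loses no list. *)
Lemma max_rec_tuple_sum V f N (u : R) : max_rec e w ps V f -> (#|V| <= N)%N -> 0 < u ->
  tuple_sum (ps 1) V N.+1 u = f u.
Proof.
move=> h; elim: h N u => {}V {}f g _ ih f1 df N u VN u0.
apply/eqP; rewrite -subr_eq0.
rewrite (@derive0_pos_cst R (fun t => tuple_sum (ps 1) V N.+1 t - f t) _ u 1) //.
  by rewrite tuple_sum_1 f1 subrr.
move=> t t0; apply: is_derive_eq.
  exact: is_deriveB (tuple_sum_derive _ _ _ t0) (df t t0).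
apply/eqP; rewrite subr_eq0; apply/eqP; apply: eq_bigr => r rV.
case: N VN => [|N VN].
  by rewrite leqn0 cards_eq0 => /eqP V0; rewrite V0 finset.inE in rV.
rewrite ih // card_prune //; lia.
Qed.

End TupleSum.

(** * Improper integrals *)

Section SimplexIntegral.
Context {R : realType}.
Notation mu := (@lebesgue_measure R).
Implicit Types (h : R -> R) (hs : seq (R -> R)) (u x : R).

Definition prim_integrand hs x : R :=
  if hs is h :: hs' then h x * iter_prim hs' x else 0.

Definition prod_fun n hs (xi : n.-tuple R) : R :=
  \prod_(j < n) nth (fun=> 0) hs j (tnth xi j).

Lemma prod_fun_cons n h hs x (s : n.-tuple R) :
  prod_fun (h :: hs) [tuple of x :: s] = h x * prod_fun hs s.
Proof.
rewrite /prod_fun big_ord_recl /= tnth0; congr (_ * _).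
by apply: eq_bigr => j _; rewrite tnthS.
Qed.

(** The factor C makes the induction work: for the inner integrals the factor of the outer variable
    is a constant. *)
Lemma simplex_int_fin n hs (C : R) u : size hs = n -> all_pos_cont hs -> 1 <= u ->
  simplex_int (fun xi : n.-tuple R => (C * prod_fun hs xi)%:E) u%:E =
  (C * iter_prim hs u)%:E.
Proof.
elim: n hs C u => [|n ih] [|h hs] C u //=.
  by rewrite /prod_fun big_ord0.
case=> szhs [ch chs] u1.
have -> : [set x : R | 1 <= x /\ (x%:E <= u%:E)%E] = `[1, u]%classic.
  by apply/seteqP; split=> x /=; rewrite in_itv /= lee_fin;
    [case=> -> ->|case/andP=> -> ->].
have u0 : 0 < u by rewrite (lt_le_trans ltr01).
pose F t := C * iter_prim (h :: hs) t.
transitivity (\int[mu]_(x in `[1%R, u]) (C * (h x * iter_prim hs x))%:E)%E.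
  apply: eq_integral => x; rewrite inE /= in_itv /= => /andP[x1 _].
  rewrite mulrA -ih //; congr (simplex_int _ _); apply/funext => s.
  by rewrite prod_fun_cons mulrA.
have cf : pos_cont (fun x => C * (h x * iter_prim hs x)).
  move=> s s0; apply: cvgM; first exact: cvg_cst.
  by apply: cvgM; [exact: ch|exact: iter_prim_continuous].
have dF (s : R) : 0 < s -> is_derive s (1 : R) F (C * (h s * iter_prim hs s)).
  by move=> s0; exact: (is_deriveZ C (iter_prim_derive (conj ch chs) s0)).
rewrite (pos_continuous_FTC2 ltr01 u1 cf dF) /F iter_prim_1 mulr0 subr0.
by [].
Qed.

(** Only the outermost variable is unbounded; the inner integrals are finite. *)
Lemma simplex_int_infty n hs : size hs = n.+1 -> all_pos_cont hs ->
  simplex_int (fun xi : n.+1.-tuple R => (prod_fun hs xi)%:E) +oo%E =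
  (\int[mu]_(x in `[1%R, +oo[) (prim_integrand hs x)%:E)%E.
Proof.
case: hs => // h hs [szhs] [ch chs] /=.
have -> : [set x : R | 1 <= x /\ (x%:E <= +oo)%E] = `[1, +oo[%classic.
  by apply/seteqP; split=> x /=; rewrite in_itv /= leey andbT; [case|].
apply: eq_integral => x; rewrite inE /= in_itv /= andbT => x1.
rewrite -(@simplex_int_fin n) //; congr (simplex_int _ _); apply/funext => s.
by rewrite prod_fun_cons.
Qed.

Fixpoint all_ge0 hs : Prop :=
  if hs is h :: hs' then (forall x, 1 <= x -> 0 <= h x) /\ all_ge0 hs' else True.

Lemma iter_prim_ge0 hs u : all_ge0 hs -> 1 <= u -> 0 <= iter_prim hs u.
Proof.
elim: hs u => [|h hs ih] u /=; first by rewrite ler01.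
case=> h0 hs0 u1; rewrite /prim1 (@set_itv_ge _ _ (BRight u)); last first.
  by rewrite bnd_simp -leNgt.
rewrite Rintegral_set0 subr0; apply: Rintegral_ge0 => x /=.
rewrite in_itv /= => /andP[/ltW x1 _].
by rewrite mulr_ge0 ?h0 ?ih.
Qed.

Lemma prim_integrand_ge0 hs x : all_ge0 hs -> 1 <= x -> 0 <= prim_integrand hs x.
Proof. by case: hs => //= h hs [h0 hs0] x1; rewrite mulr_ge0 ?h0 ?iter_prim_ge0. Qed.

Lemma prim_integrand_continuous hs : all_pos_cont hs -> pos_cont (prim_integrand hs).
Proof.
case: hs => [_ x _|h hs [ch chs] x x0]; first exact: cvg_cst.
by apply: cvgM; [exact: ch|exact: iter_prim_continuous].
Qed.

Lemma pos_cont_measurable f : pos_cont f -> measurable_fun (`[1, +oo[ : set R) f.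
Proof.
move=> cf; apply: (@measurable_funS _ _ _ _ (`]0, +oo[ : set R)) => //.
  by move=> x /=; rewrite !in_itv /= !andbT; exact: lt_le_trans.
apply: open_continuous_measurable_fun; first exact: interval_open.
by move=> x; rewrite inE /= in_itv /= andbT => /cf.
Qed.

Variables (T : finType) (e : rel T) (w ps : R -> R).
Hypothesis e_irr : irreflexive e.
Hypothesis cw : pos_cont w.
Hypothesis cps : pos_cont ps.
Hypothesis w0 : forall x, 1 <= x -> 0 <= w x.
Hypothesis ps0 : forall x, 1 <= x -> 0 <= ps x.
Implicit Types (V : {set T}) (s : seq T).

Lemma weights_ge0 V s : all_ge0 (weights e w ps V s).
Proof.
rewrite /weights; elim: (degs e V s) => //= n ns ih; split=> // x x1.
by rewrite mulr_ge0 ?exprn_ge0 ?w0 ?ps0.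
Qed.

(** Finiteness of a single term is not known beforehand. Nonnegativity allows the whole sum to be
    integrated at once, and its primitive f has a limit at infinity. The list of length 0 is the
    constant [ps 1 ^+ #|V|], the value of f at 1. *)
Lemma sum_integral_max_rec V f (l : R) N :
  max_rec e w ps V f -> (#|V| <= N)%N -> f u @[u --> +oo] --> l ->
  (\sum_(0 <= n < N) \sum_(s : n.+1.-tuple T | indep_in e V s)
     (ps 1 ^+ free e V s)%:E *
     \int[mu]_(x in `[1%R, +oo[) (prim_integrand (weights e w ps V s) x)%:E =
   (l - ps 1 ^+ #|V|)%:E)%E.
Proof.
move=> hf VN fl; have q0 : 0 <= ps 1 by rewrite ps0.
pose g (s : seq T) x := ps 1 ^+ free e V s * prim_integrand (weights e w ps V s) x.
have g0 s x : 1 <= x -> 0 <= g s x.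
  move=> x1; apply: mulr_ge0; first exact: exprn_ge0.
  by apply: prim_integrand_ge0 => //; exact: weights_ge0.
have cg s : pos_cont (g s).
  move=> x x0; apply: cvgM; first exact: cvg_cst.
  by apply: prim_integrand_continuous => //; exact: weights_cont.
pose G n x := \sum_(s : n.+1.-tuple T | indep_in e V s) g s x.
have G0 n x : 1 <= x -> 0 <= G n x by move=> x1; apply: sumr_ge0 => s _; exact: g0.
have csum (I : finType) (P : pred I) (F : I -> R -> R) :
    (forall i, pos_cont (F i)) -> pos_cont (fun x => \sum_(i | P i) F i x).
  move=> cF x x0; apply: cvg_big => [|i _]; [exact: add_continuous|exact: cF].
have cG n : pos_cont (G n) by apply: csum => s; exact: cg.
transitivity (\int[mu]_(x in `[1%R, +oo[) (\sum_(0 <= n < N) G n x)%:E)%E.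
  under [RHS]eq_integral do rewrite -sumEFin.
  rewrite ge0_integral_sum //; last 2 first.
  - by move=> n; apply/measurable_EFinP; exact: pos_cont_measurable.
  - by move=> n x /=; rewrite in_itv /= andbT lee_fin => /G0.
  apply: eq_bigr => n _; rewrite /G.
  under [RHS]eq_integral do rewrite -sumEFin -big_filter.
  rewrite ge0_integral_sum //; last 2 first.
  - by move=> s; apply/measurable_EFinP; exact: pos_cont_measurable.
  - by move=> s x /=; rewrite in_itv /= andbT lee_fin => /g0.
  rewrite big_filter; apply: eq_bigr => s _.
  rewrite -ge0_integralZl_EFin //.
  - by move=> x /=; rewrite in_itv /= andbT lee_fin => x1;
      apply: prim_integrand_ge0 => //; exact: weights_ge0.
  - apply/measurable_EFinP; apply: pos_cont_measurable.
    by apply: prim_integrand_continuous; exact: weights_cont.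
  - exact: exprn_ge0.
pose F := tuple_sum e w ps (ps 1) V N.+1.
have FE u : 0 < u -> F u = f u.
  by move=> u0; exact: (max_rec_tuple_sum e_irr cw cps hf VN u0).
have dF (u : R) : 0 < u -> is_derive u (1 : R) F (\sum_(0 <= n < N) G n u).
  move=> u0; pose F' t := ps 1 ^+ #|V| + \sum_(0 <= n < N)
     \sum_(s : n.+1.-tuple T | indep_in e V s)
        ps 1 ^+ free e V s * iter_prim (weights e w ps V s) t.
  have -> : F = F'.
    apply/funext => t; rewrite /F /F' /tuple_sum big_nat_recl //; congr (_ + _).
    rewrite (@sum_tuple0 _ _ (indep_in e V)
      (fun s => ps 1 ^+ free e V s * iter_prim (weights e w ps V s) t)) //.
    by rewrite /free /= !subn0 mulr1.
  have dS (n : nat) : is_derive u (1 : R)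
      (fun t => \sum_(s : n.+1.-tuple T | indep_in e V s)
        ps 1 ^+ free e V s * iter_prim (weights e w ps V s) t) (G n u).
    apply: is_derive_big => s _; rewrite /g; apply: is_deriveZ.
    have := weights_cont e cw cps V s.
    by case: s => -[//|r s] szs cs; exact: (iter_prim_derive cs u0).
  have dG := is_derive_big (index_iota 0 N) (P := xpredT) (fun n _ => dS n).
  by apply: is_derive_eq (is_deriveD (is_derive_cst (ps 1 ^+ #|V|) u 1) dG) _;
    rewrite add0r.
have F1 : F 1 = ps 1 ^+ #|V| by rewrite /F tuple_sum_1.
rewrite -F1 EFinB; apply: ge0_continuous_FTC2y.
- by move=> x x1; apply: sumr_ge0 => n _; exact: G0.
- apply: continuous_in_subspaceT => x; rewrite inE /= in_itv /= andbT => x1.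
  apply: cvg_big => [|n _]; [exact: add_continuous|].
  by apply: cG; exact: lt_le_trans x1.
- apply: cvg_trans fl; apply: near_eq_cvg; near=> u; apply/esym/FE.
  by near: u; exact: nbhs_pinfty_gt.
- by move=> x x1; have [] := dF _ (lt_trans ltr01 x1).
- exact/cvg_at_right_filter/(is_derive_continuous (dF _ ltr01)).
- move=> x; rewrite in_itv /= andbT => x1; rewrite derive1E.
  by have [_] := dF _ (lt_trans ltr01 x1).
Unshelve. all: by end_near. Qed.

End SimplexIntegral.

(** * Admissible tuples as independent lists on the cycle *)

Section Dictionary.
Context {R : realType}.

Section Prune.
Variables (T : finType) (e : rel T).
Implicit Types (V : {set T}) (s : seq T).

Lemma mem_foldl_prune V s z : (z \in foldl (prune e) V s) =
  (z \in V) && all (fun r => (z != r) && ~~ e r z) s.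
Proof.
elim: s V => [|r s ih] V /=; first by rewrite andbT.
by rewrite ih /prune !finset.inE negb_or; case: (z \in V); rewrite ?andbT ?andbF.
Qed.

Lemma indep_inP x0 V s : reflect
  (forall j, (j < size s)%N -> nth x0 s j \in foldl (prune e) V (take j s))
  (indep_in e V s).
Proof.
elim: s V => [|r s ih] V /=; first by constructor.
apply: (iffP andP) => [[rV /ih h] [|j] //= js|h]; first exact: h.
by split; [exact: (h 0%N)|apply/ih => j js; exact: (h j.+1)].
Qed.

Lemma size_degs V s : size (degs e V s) = size s.
Proof. by elim: s V => //= r s ih V; rewrite ih. Qed.

Lemma nth_degs x0 V s j : (j < size s)%N -> nth 0%N (degs e V s) j =
  #|nbh e (nth x0 s j) :&: foldl (prune e) V (take j s)|.
Proof. by elim: s V j => // r s ih V [|j] //= js; exact: ih. Qed.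

End Prune.

Variable k : nat.
Hypothesis k2 : (1 < k)%N.

Let k0 : (0 < k)%N. Proof. exact: ltnW. Qed.

Lemma cyc_rel_irr : irreflexive (@cyc_rel k).
Proof.
move=> x; rewrite cyc_relE // orbC eq_sym orbb (ordS_rot0 k2) -[X in _ == X](rot_ord0 k2).
by apply/negbTE/eqP => /rot_ord_inj; lia.
Qed.

Lemma val_ordS (x : 'I_k) : val (ordS x) = if x.+1 == k then 0%N else x.+1.
Proof.
rewrite /=; case: eqVneq => [->|xk]; first by rewrite modnn.
by rewrite modn_small //; have := ltn_ord x; lia.
Qed.

Lemma cyc_dist (x y : 'I_k) :
  (`|x%:Z - y%:Z|%N \in [:: 0; 1; k - 1]%N) = (x == y) || cyc_rel x y.
Proof.
rewrite cyc_relE // -!val_eqE !val_ordS !finset.inE /=.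
have := ltn_ord x; have := ltn_ord y.
by case: (boolP (y.+1 == k :> nat)) => ?; case: (boolP (x.+1 == k :> nat)) => ?; lia.
Qed.

Lemma admissibleP n (r : n.-tuple 'I_k) : reflect
  (forall i j : 'I_n, i != j -> (tnth r i != tnth r j) && ~~ cyc_rel (tnth r i) (tnth r j))
  (admissible r).
Proof.
apply: (iffP forallP) => [h i j ij|h i].
  by move/forallP/(_ j)/implyP/(_ ij): (h i); rewrite cyc_dist negb_or.
by apply/forallP => j; apply/implyP => ij; rewrite cyc_dist negb_or h.
Qed.

Lemma admissible_indep n (r : n.-tuple 'I_k) :
  admissible r = indep_in (@cyc_rel k) [set: 'I_k]%SET r.
Proof.
pose x0 := Ordinal k0.
apply/admissibleP/(indep_inP _ x0) => [h j|h].
  rewrite size_tuple => jn; rewrite mem_foldl_prune finset.inE /=.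
  apply/(all_nthP x0) => m; rewrite size_take size_tuple jn => mj.
  have mn : (m < n)%N by exact: ltn_trans jn.
  rewrite nth_take // -(tnth_nth x0 r (Ordinal jn)) -(tnth_nth x0 r (Ordinal mn)).
  rewrite cyc_rel_sym // h // -val_eqE /=; lia.
have key (i j : 'I_n) : (i < j)%N ->
    (tnth r i != tnth r j) && ~~ cyc_rel (tnth r i) (tnth r j).
  move=> ij; have := h j; rewrite size_tuple ltn_ord => /(_ isT).
  rewrite mem_foldl_prune => /andP[_ /(all_nthP x0) /(_ i)].
  rewrite size_take size_tuple ltn_ord ij => /(_ isT).
  by rewrite nth_take // -!tnth_nth eq_sym.
move=> i j; rewrite -val_eqE neq_ltn => /orP[/key //|/key].
by rewrite eq_sym cyc_rel_sym.
Qed.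

(** [alpha] excludes neighbours of earlier entries, pruning also the entries themselves; these agree
    because a neighbour of r_j is not an entry of an admissible tuple. *)
Lemma alpha_degs n (r : n.-tuple 'I_k) (j : 'I_n) : admissible r ->
  alpha r j = nth 0%N (degs (@cyc_rel k) [set: 'I_k]%SET r) j.
Proof.
move=> adm; pose x0 := Ordinal k0.
rewrite (nth_degs _ x0) ?size_tuple // -tnth_nth nbh_cyc /alpha.
apply: eq_card => z; rewrite finset.in_setI mem_foldl_prune finset.in_setT andTb.
rewrite finset.in_set; case zj : (z \in cyc_nbrs (tnth r j)); rewrite ?andFb // !andTb.
apply/forallP/(all_nthP x0) => [h m|h m].
  rewrite size_take size_tuple ltn_ord => mj.
  have mn : (m < n)%N by exact: ltn_trans (ltn_ord j).
  rewrite nth_take // -(tnth_nth x0 r (Ordinal mn)).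
  have /implyP -> // := h (Ordinal mn); rewrite andbT; apply/eqP => zm.
  move/admissibleP : adm => /(_ j (Ordinal mn)) /=.
  rewrite -val_eqE /= neq_ltn mj orbT => /(_ isT) /andP[_].
  by rewrite -zm /cyc_rel zj.
apply/implyP => mj; have := h m; rewrite size_take size_tuple ltn_ord mj.
by move=> /(_ isT) /andP[_]; rewrite nth_take // -tnth_nth.
Qed.

Lemma free_exp_free n (r : n.-tuple 'I_k) : admissible r ->
  free_exp r = free (@cyc_rel k) [set: 'I_k]%SET r.
Proof.
move=> adm; rewrite /free_exp /free cardsT card_ord size_tuple; congr (_ - _)%N.
rewrite sumnE (big_nth 0%N) size_degs size_tuple big_mkord.
by apply: eq_bigr => j _; rewrite alpha_degs.
Qed.

Lemma prod_fun_weights (w ps : R -> R) n (r : n.-tuple 'I_k) (xi : n.-tuple R) :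
  admissible r ->
  prod_fun (weights (@cyc_rel k) w ps [set: 'I_k]%SET r) xi =
  \prod_(j < n) (w (tnth xi j) * ps (tnth xi j) ^+ alpha r j).
Proof.
move=> adm; apply: eq_bigr => j _; rewrite /weights (nth_map 0%N).
  by rewrite alpha_degs.
by rewrite size_degs size_tuple.
Qed.

(** The n entries and their n cyclic successors are 2n distinct indices. *)
Lemma admissible_size n (r : n.-tuple 'I_k) : admissible r -> (n <= k %/ 2)%N.
Proof.
move=> /admissibleP adm.
have inj : injective (tnth r).
  move=> i j rij; apply/eqP; apply: contraT => /adm.
  by rewrite rij eqxx.
pose A : {set 'I_k} := [set tnth r i | i in 'I_n]%SET.
have cA : #|A| = n by rewrite card_imset // card_ord.
have cB : #|[set ordS x | x in A]%SET| = n.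
  by rewrite card_imset //; exact: (can_inj (@ordSK k)).
have disj : A :&: [set ordS x | x in A]%SET = finset.set0.
  apply/setP => x; rewrite !finset.inE; apply/negbTE/negP => /andP[].
  case/imsetP => i _ -> /imsetP[y /imsetP[j _ ->] ij].
  have := cyc_relE (tnth r j) (tnth r i); rewrite ij eqxx orbT => eij.
  have [ji|/adm/andP[_]] := eqVneq j i; last by rewrite ij eij.
  by move: eij; rewrite -ij ji cyc_rel_irr.
have := max_card (mem (A :|: [set ordS x | x in A]%SET)).
by rewrite cardsU disj cards0 subn0 cA cB card_ord; lia.
Qed.

End Dictionary.

(** * From the cycle recursion to the J and K sums, and the theorem *)

Section Assembly.
Context {R : realType}.
Notation mu := (@lebesgue_measure R).

Lemma Rintegral_psi1 (c : R) a d t : (0 < d)%N ->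
  \int[mu]_(x in `[0, t]) (c * (x ^+ d.-1 / (1 + x ^+ a))) = c * psi1 a d t.
Proof.
move=> d0; rewrite /psi1 /=.
have [t0|t0] := ltP 0 t; last first.
  have -> : prim0 (fun x => kw a d x * 1) t = 0.
    by rewrite /prim0 set_itv_ge ?Rintegral_set0 // bnd_simp -leNgt.
  rewrite mulr0; move: t0; rewrite le_eqVlt => /predU1P[->|t0].
    by rewrite set_itv1 Rintegral_set1.
  by rewrite set_itv_ge ?Rintegral_set0 // bnd_simp -ltNge.
have i0 : mu.-integrable `]0, t] (EFin \o (fun x => kw a d x * 1)).
  apply: (@integrable_prim0 _ _ 1) => s s0.
    by apply: cvgM; [exact: kw_continuous|exact: cvg_cst].
  move=> s1; rewrite mulr1 ger0_norm ?kw_ge0 // (le_trans (kw_le a d s0)) //.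
  by rewrite exprn_ile1 // ltW.
rewrite /prim0 -RintegralZl //.
rewrite Rintegral_itv_obnd_cbnd.
  by apply: eq_Rintegral => x _; rewrite mulr1.
apply: (@integrable_prim0 _ _ `|c|) => s s0.
  apply: cvgM; first exact: cvg_cst.
  by apply: cvgM; [exact: kw_continuous|exact: cvg_cst].
move=> s1; rewrite mulr1 normrM ler_piMr // ger0_norm ?kw_ge0 //.
by rewrite (le_trans (kw_le a d s0)) // exprn_ile1 // ltW.
Qed.

Lemma psi1_ge0 a d (t : R) : 0 <= psi1 a d t.
Proof.
rewrite /psi1 /=; apply: Rintegral_ge0 => x /=; rewrite in_itv /= => /andP[x0 _].
by rewrite mulr1 kw_ge0.
Qed.

(** The sine constant is absorbed into both weights, which multiplies the cycle integral by c^k; d =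
    1 gives the J-sum and d = a - 1 the K-sum. *)
Lemma sum_simplex_int a d k (c : R) : (0 < d)%N -> (d < a)%N -> (0 < k)%N -> 0 <= c ->
  let w x := c * kw a d x in
  let ps x := c * psi1 a d x^-1 in
  (\sum_(1 <= n < (k %/ 2).+1) \sum_(r : n.-tuple 'I_k | admissible r)
     (ps 1 ^+ free_exp r)%:E *
     simplex_int (fun xi : n.-tuple R =>
       (\prod_(j < n) (w (tnth xi j) * ps (tnth xi j) ^+ alpha r j))%:E) +oo%E =
   (c ^+ k * coef (odeC a d) k - ps 1 ^+ k)%:E)%E.
Proof.
move=> d0 da k0 c0 w ps.
pose Cf (u : R) := c ^+ k * coef (fredC a d u^-1) k.
have Cf1 : Cf 1 = ps 1 ^+ k by rewrite /Cf /ps invr1 fredC_1 // exprMn.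
have Cfy : Cf u @[u --> +oo] --> c ^+ k * coef (odeC a d) k.
  by apply: cvgM; [exact: cvg_cst|exact: cycle_cvgy].
have dCf0 (u : R) : 0 < u -> is_derive u (1 : R) Cf _ :=
  fun u0 => is_deriveZ (c ^+ k) (cycle_derive d0 da k u0).
(* For k = 1 the only index is its own neighbour, so the cycle recursion does not apply; the sum is
   empty and the coefficient of [fredC] is constant. *)
have [k1|k1] := leqP k 1.
  have kE : k = 1%N by apply/eqP; rewrite eqn_leq k1.
  rewrite big_geq; last by rewrite kE.
  suff -> : c ^+ k * coef (odeC a d) k = ps 1 ^+ k by rewrite subrr.
  have Cc (u : R) : 0 < u -> Cf u = Cf 1.
    move=> u0; apply: (@derive0_pos_cst R Cf) => // s s0.
    by apply: is_derive_eq (dCf0 s s0) _; rewrite kE /= scaler0.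
  have lc : (fun _ : R => Cf 1) u @[u --> +oo] --> c ^+ k * coef (odeC a d) k.
    apply: (cvg_trans _ Cfy); apply: near_eq_cvg; near=> u; apply: Cc.
    by near: u; exact: nbhs_pinfty_gt.
  have lc1 : (fun _ : R => Cf 1) u @[u --> +oo] --> Cf 1 by exact: cvg_cst.
  by rewrite -Cf1; exact: (cvg_unique (@Rhausdorff R) lc lc1).
pose Pf n (u : R) := c ^+ n * coef (fredP a d u^-1) n.
have Pf1 n : Pf n 1 = ps 1 ^+ n by rewrite /Pf /ps invr1 fredP_1 // exprMn.
have factorE i (u : R) : path_factor ps Pf i u = c ^+ i * pathE a d i u.
  case: i => [|i]; rewrite /path_factor /pathE ?mulr1 // /ps /Pf exprS; ring.
have dPf n (u : R) : 0 < u -> is_derive u (1 : R) (Pf n)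
    (w u * if n is m.+1 then
       \sum_(i < m.+1) path_factor ps Pf i u * path_factor ps Pf (m - i) u else 0).
  move=> u0; apply: is_derive_eq (is_deriveZ (c ^+ n) (path_derive d0 da n u0)) _.
  rewrite /w /GRing.scale /=; case: n => [|m]; first by rewrite !mulr0.
  rewrite !mulr_sumr; apply: eq_bigr => i _; rewrite !factorE.
  have -> : c ^+ m.+1 = c * c ^+ i * c ^+ (m - i).
    by rewrite -mulrA -exprD subnKC -?exprS // -ltnS.
  ring.
have dCf (u : R) : 0 < u -> is_derive u (1 : R) Cf
    (k%:R * (w u * ps u * path_factor ps Pf (k - 2) u)).
  move=> u0; apply: is_derive_eq (dCf0 u u0) _.
  rewrite factorE /w /ps /GRing.scale /=.
  case: (k) k1 => [//|[//|m]] _; rewrite subSS subSS subn0 !exprS; ring.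
have cw : pos_cont w.
  by move=> s s0; apply: cvgM; [exact: cvg_cst|exact: kw_continuous].
have cps : pos_cont ps.
  move=> s s0; apply: cvgM; first exact: cvg_cst.
  apply: (@cvg_comp _ _ _ GRing.inv (psi1 a d) _ (nbhs s^-1)).
    by apply: cvgV => //; rewrite gt_eqF.
  by apply: (is_derive_continuous (psi1_derive d0 da _)); rewrite invr_gt0.
have w0 x : 1 <= x -> 0 <= w x.
  by move=> x1; rewrite mulr_ge0 // kw_ge0 // (lt_le_trans ltr01).
have ps0 x : 1 <= x -> 0 <= ps x by move=> x1; rewrite mulr_ge0 // psi1_ge0.
have hC := max_rec_cycle k1 Pf1 dPf Cf1 dCf.
have := sum_integral_max_rec (@cyc_rel_irr k k1) cw cps w0 ps0 hC (leqnn _) Cfy.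
rewrite cardsT card_ord => <-.
(* Lengths between k/2 and k can be added since no admissible tuple has them. *)
rewrite [RHS](_ : _ = \sum_(1 <= n < k.+1) \sum_(r : n.-tuple 'I_k | admissible r)
     (ps 1 ^+ free_exp r)%:E *
     simplex_int (fun xi : n.-tuple R =>
       (\prod_(j < n) (w (tnth xi j) * ps (tnth xi j) ^+ alpha r j))%:E) +oo%E)%E.
  rewrite [RHS](@big_cat_nat _ _ _ (k %/ 2).+1) //=; last first.
    by rewrite ltnS leq_div.
  rewrite [X in (_ + X)%E]big_nat_cond [X in (_ + X)%E]big1 ?adde0 //.
  move=> n; rewrite andbT => /andP[nk _]; rewrite big_pred0 // => r.
  by apply/negbTE; apply: contraL nk => /(admissible_size k1); rewrite -leqNgt.
rewrite big_add1 -pred_Sn; apply: eq_bigr => n _.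
apply: eq_big => [s|s]; rewrite -(admissible_indep k1) // => adm.
rewrite (free_exp_free k1) //; congr (_ * _)%E.
rewrite -(@simplex_int_infty R n) //; last 2 first.
- by rewrite /weights size_map size_degs size_tuple.
- exact: weights_cont.
by congr (simplex_int _ _); apply/funext => xi; rewrite (prod_fun_weights k1).
Unshelve. all: by end_near. Qed.

End Assembly.

Theorem mainTheorem4 (R : realType) (a k : nat) (ha : (2 <= a)%N)
    (hk : (1 <= k)%N) :
  let Spos := series (fun n : nat => lhs_term R a k n%:Z) in
  let Sneg := series (fun n : nat => lhs_term R a k (- (n.+1)%:Z)) in
  [/\ cvgn Spos, cvgn Sneg &
      (limn Spos + limn Sneg)%:E =
      ((((pi / a%:R) * (sin (pi / a%:R))^-1) ^+ k)%R%:E *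
       (((\int[lebesgue_measure]_(xi in `[0%R : R, 1%R])
            ((a%:R / pi * sin (pi / a%:R)) / (1 + xi ^+ a))) ^+ k)%R%:E
        + ((\int[lebesgue_measure]_(theta in `[0%R : R, 1%R])
            ((a%:R / pi * sin (pi / a%:R)) * theta ^+ (a - 2) /
             (1 + theta ^+ a))) ^+ k)%R%:E
        + \sum_(1 <= n < (k %/ 2).+1)
            \sum_(r : n.-tuple 'I_k | admissible r)
              (Jint R a r + Kint R a r)))%E].
Proof.
have a0 : (0 < a)%N by exact: ltnW.
have a0' : 0 < a%:R :> R by rewrite ltr0n.
set c : R := a%:R / pi * sin (pi / a%:R).
have s0 : 0 < sin (pi / a%:R) :> R.
  apply: sin_gt0_pi; rewrite divr_gt0 ?pi_gt0 //=.
  by rewrite ltr_pdivrMr // ltr_pMr ?pi_gt0 // ltr1n.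
have c0 : 0 < c by rewrite mulr_gt0 // divr_gt0 // pi_gt0.
have cE : pi / a%:R * (sin (pi / a%:R))^-1 = c^-1 :> R.
  by rewrite /c invfM invf_div.
have cs : cst_sin R a = c by [].
(* The prefactor is c^-k and the bracket is c^k (C_k(1) + C_k(a - 1)), so the sine constant
   cancels. *)
clearbody c.
have d1 : (1 < a)%N by [].
have e0 : (0 < a - 1)%N by rewrite subn_gt0.
have ea : (a - 1 < a)%N by rewrite ltn_subrL a0.
have ePred : (a - 1).-1 = (a - 2)%N by lia.
have psiE t : psi a t = c * psi1 a 1 t.
  rewrite -Rintegral_psi1 //; apply: eq_Rintegral => x _.
  by rewrite cs expr0 div1r.
have phiE t : phi a t = c * psi1 a (a - 1) t.
  rewrite -Rintegral_psi1 //; apply: eq_Rintegral => x _.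
  by rewrite cs ePred mulrA.
have lim1 : series (fun n : nat => lhs_term R a k n%:Z) @ \oo --> coef (odeC a 1) k.
  rewrite (_ : (fun n : nat => _) =
    (fun m : nat => (-1) ^+ (m * k) / (1 + m * a)%:R ^+ k)); first exact: powersum_cvg.
  apply/funext => n; rewrite /lhs_term -PoszM -exprnP; congr (_ / _ ^+ _).
  by rewrite -PoszM -[X in (_ + X)%:~R]/(1%:Z) -PoszD -pmulrn addnC mulnC.
have lim2 : series (fun n : nat => lhs_term R a k (- (n.+1)%:Z)) @ \oo -->
    coef (odeC a (a - 1)) k.
  rewrite (_ : (fun n : nat => _) =
    (fun m : nat => (-1) ^+ (m * k) / (a - 1 + m * a)%:R ^+ k)); first exact: powersum_cvg.
  have sV j : ((-1) ^+ j)^-1 = (-1) ^+ j :> R by rewrite -exprVn invrN1.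
  apply/funext => n; rewrite /lhs_term mulNr -PoszM -exprnN sV.
  have -> : (a%:Z * - n.+1%:Z + 1)%:~R = - (a - 1 + n * a)%:R :> R.
    have -> : a%:Z * - n.+1%:Z + 1 = - (a - 1 + n * a)%N%:Z by lia.
    by rewrite mulrNz -pmulrn.
  (* The (-1)^k from the negative base cancels the one in (-1)^((n+1)k). *)
  rewrite [(- _%:R) ^+ k]exprNn invfM sV mulSn exprD mulrACA -expr2 sqrr_sign mul1r.
  by [].
move=> Spos Sneg; split; [exact: cvgP lim1|exact: cvgP lim2|].
rewrite (cvg_lim (@Rhausdorff R) lim1) (cvg_lim (@Rhausdorff R) lim2).
have J1 := @sum_simplex_int R a 1 k c isT d1 hk (ltW c0).
have K1 := @sum_simplex_int R a (a - 1) k c e0 ea hk (ltW c0).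
set C1 := coef (odeC a 1) k in J1 *.
set Ce := coef (odeC a (a - 1)) k in K1 *.
have -> : \int[lebesgue_measure]_(xi in `[0%R : R, 1%R]) (c / (1 + xi ^+ a)) =
    c * psi1 a 1 1 by rewrite -psiE /psi cs.
have -> : \int[lebesgue_measure]_(xi in `[0%R : R, 1%R])
   (c * xi ^+ (a - 2) / (1 + xi ^+ a)) = c * psi1 a (a - 1) 1 by rewrite -phiE /phi cs.
have JE n (r : n.-tuple 'I_k) : Jint R a r =
    (((c * psi1 a 1 1^-1) ^+ free_exp r)%:E * simplex_int (fun xi : n.-tuple R =>
     (\prod_(j < n) (c * kw a 1 (tnth xi j) *
        (c * psi1 a 1 (tnth xi j)^-1) ^+ alpha r j))%:E) +oo)%E.
  rewrite /Jint invr1 psiE; congr (_ * simplex_int _ _)%E; apply/funext => xi.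
  congr (_%:E); rewrite big_split big_split /= prodr_const card_ord.
  rewrite /kw; under [X in _ = _ * X * _]eq_bigr do rewrite expr0 div1r.
  rewrite prodfV cs; under eq_bigr do rewrite div1r psiE.
  by rewrite mulrAC.
have KE n (r : n.-tuple 'I_k) : Kint R a r =
    (((c * psi1 a (a - 1) 1^-1) ^+ free_exp r)%:E * simplex_int (fun xi : n.-tuple R =>
     (\prod_(j < n) (c * kw a (a - 1) (tnth xi j) *
        (c * psi1 a (a - 1) (tnth xi j)^-1) ^+ alpha r j))%:E) +oo)%E.
  rewrite /Kint invr1 phiE; congr (_ * simplex_int _ _)%E; apply/funext => xi.
  congr (_%:E); rewrite !big_split /= prodr_const card_ord.
  rewrite prodfV ePred cs.
  under eq_bigr do rewrite div1r phiE.
  by ring.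
under eq_bigr do under eq_bigr do rewrite JE KE.
under eq_bigr do rewrite big_split.
rewrite big_split /= J1 K1 !invr1 -!EFinD -EFinM; congr (_%:E).
rewrite cE exprVn.
have ck : c ^+ k != 0 by rewrite expf_neq0 // gt_eqF.
by field.
Qed.
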